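(* Let $p,q$ be coprime integers with $q\ge 1$, and let $F(x,\mu)$ be a family of lifts in class $\mathcal{R}_{p,q}$ in a neighbourhood $|\mu|<\mu_0$ of $\mu=0$, i.e. $$F(x,\mu)=x+\frac{p}{q}+\mu\,(a+\psi(x))+\mu^2 g(x,\mu),\qquad |\mu|<\mu_0,$$ with $a>0$. Let $\rho(\mu)=\rho(F(\cdot,\mu))$ be the rotation number. Denote the Fourier coefficients of $\psi$ by $(c_m)_{m\in\mathbb{Z}}$ (so $c_0=0$) and define $$\Psi(x)=\sum_{n\in\mathbb{Z}\setminus\{0\}}c_{nq}\,e^{2\pi i nqx}.$$ (1) If $\min_{x\in[0,1]}(a+\Psi(x))>0$, then $\rho(\mu)$ is differentiable at $\mu=0$ and $$\rho'(0)=T_0^{-1},\qquad T_0=\int_0^1\frac{1}{a+\Psi(x)}\,dx.$$ (2) If $\min_{x\in[0,1]}(a+\Psi(x))<0<\max_{x\in[0,1]}(a+\Psi(x))$, then there exists $\mu_1\in(0,\mu_0)$ such that $\rho(\mu)=\frac{p}{q}$ for all $|\mu|<\mu_1$, and so $\rho$ is differentiable at $\mu=0$ with $\rho'(0)=0$.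
   Context: A lift of an orientation preserving circle homeomorphism is a continuous increasing function $F:\mathbb{R}\to\mathbb{R}$ with $F(x+1)=F(x)+1$. Its rotation number is $\rho(F)=\lim_{n\to\infty}\frac1n(F^n(x)-x)$, where $F^n$ is the $n$-fold composition; the limit exists and does not depend on $x$. A family of lifts $F(x,\mu)$ (for each $\mu$, $x\mapsto F(x,\mu)$ is a lift of an orientation preserving circle homeomorphism) is in class $\mathcal{R}_{p,q}$ in a neighbourhood of $\mu=0$ if there exists $\mu_0>0$ such that for all $|\mu|<\mu_0$, $F(x,\mu)=x+\frac{p}{q}+\mu(a+\psi(x))+\mu^2g(x,\mu)$, where $p$ and $q$ are coprime, $a$ is a real constant, $\psi$ is a real $C^1$ function, periodic with period one, with $\int_0^1\psi(x)\,dx=0$, and $g(x,\mu)$ is bounded, continuous in $\mu$, and for each $\mu\in(-\mu_0,\mu_0)$ is a $C^1$ function of $x$, periodic with period one. Primes on $\rho$ denote derivatives with respect to $\mu$. The Fourier coefficients are $c_m=\int_0^1\psi(x)e^{-2\pi i mx}\,dx$. *)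

(* Defs.v *)
From Stdlib Require Export Reals ZArith Znumtheory.
From Coquelicot Require Export Coquelicot.

Open Scope R_scope.

Definition is_lift (F : R -> R) : Prop :=
  (forall x, continuous F x) /\
  (forall x y, x < y -> F x < F y) /\
  (forall x, F (x + 1) = F x + 1).

Definition is_rotation_number (F : R -> R) (r : R) : Prop :=
  forall x, is_lim_seq (fun n => (Nat.iter n F x - x) / INR n) r.

(* [iota] selects the unique real with the given property; for a lift it
   exists (Poincare). *)
Definition rotation_number (F : R -> R) : R :=
  iota (T := R_CompleteNormedModule) (is_rotation_number F).

Definition periodic1 (f : R -> R) : Prop := forall x, f (x + 1) = f x.

Definition C1 (f : R -> R) : Prop :=
  forall x, ex_derive f x /\ continuous (Derive f) x.

(* The class R_{p,q} with its data [mu0], [a], [psi], [g] made explicit.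
   [F x mu] is constrained only for [Rabs mu < mu0]. *)
Record class_R (p q : Z) (F : R -> R -> R) (mu0 a : R)
    (psi : R -> R) (g : R -> R -> R) : Prop := {
  class_R_mu0 : 0 < mu0;
  class_R_coprime : rel_prime p q;
  class_R_lift : forall mu, Rabs mu < mu0 -> is_lift (fun x => F x mu);
  class_R_form : forall x mu, Rabs mu < mu0 ->
    F x mu = x + IZR p / IZR q + mu * (a + psi x) + mu ^ 2 * g x mu;
  class_R_psi_C1 : C1 psi;
  class_R_psi_periodic : periodic1 psi;
  class_R_psi_mean : RInt psi 0 1 = 0;
  class_R_g_bounded : exists M, forall x mu, Rabs mu < mu0 ->
    Rabs (g x mu) <= M;
  class_R_g_cont : forall x mu, Rabs mu < mu0 ->
    continuous (fun nu => g x nu) mu;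
  class_R_g_C1 : forall mu, Rabs mu < mu0 -> C1 (fun x => g x mu);
  class_R_g_periodic : forall mu, Rabs mu < mu0 -> periodic1 (fun x => g x mu)
}.

Definition cexpi (t : R) : C := (cos t, sin t).

Definition fourier_coef (psi : R -> R) (m : Z) : C :=
  RInt (V := C_R_CompleteNormedModule)
    (fun x => Cmult (RtoC (psi x)) (cexpi (- (2 * PI * IZR m * x)))) 0 1.

Definition fourier_term (psi : R -> R) (m : Z) (x : R) : C :=
  Cmult (fourier_coef psi m) (cexpi (2 * PI * IZR m * x)).

(* The sum over the nonzero integers n is taken as the limit of the symmetric
   partial sums over 0 < |n| <= N: the n-th term of the series below is the
   pair of indices n+1 and -(n+1). *)
Definition PsiC (psi : R -> R) (q : Z) (x : R) : C :=
  iota (T := C_R_CompleteNormedModule)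
    (is_series (V := C_R_NormedModule) (fun n : nat =>
       Cplus (fourier_term psi (Z.of_nat (S n) * q) x)
             (fourier_term psi (- Z.of_nat (S n) * q) x))).

(* The sum is real, since psi is real and c_{-m} is the conjugate of c_m. *)
Definition Psi (psi : R -> R) (q : Z) (x : R) : R := Re (PsiC psi q x).

Definition is_min_on (f : R -> R) (u v m : R) : Prop :=
  (exists x, u <= x <= v /\ f x = m) /\ (forall x, u <= x <= v -> m <= f x).

Definition is_max_on (f : R -> R) (u v m : R) : Prop :=
  (exists x, u <= x <= v /\ f x = m) /\ (forall x, u <= x <= v -> f x <= m).

(* Main.v *)
From Stdlib Require Import Lra Lia Psatz.
Require Import Defs.

(** The proof averages the perturbation over one turn of the unperturbed
    rotation. Let [A x] be the mean of [psi] over the [q] points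
    [x + j * p / q], and [f = a + A].

    _The return map._ Up to [O(mu)] an orbit of [F(., mu)] follows the rotation by
    [p / q], so [q] steps move [x] to [x + p + mu * q * f x + O(mu ^ 2)],
    uniformly in [x] ([class_R_return_map_expansion]). Hence [F^q - p] is close to
    the time [mu * q] map of the flow of the vector field [f].

    _A positive field._ If [f > 0], the travel time [H x], the integral of [1 / f]
    from [0] to [x], straightens this flow: [H (F^q x - p) = H x + mu * q +
    O(mu ^ 2)] and [H (x + 1) = H x + T0]. Following an orbit, the rotation number
    [rho] satisfies [T0 * (q * rho - p) = mu * q + O(mu ^ 2)], that is
    [rho = p / q + mu / T0 + O(mu ^ 2)]
    ([rotation_number_of_near_translation],
    [rotation_number_derivative_positive_field]).

    _A field changing sign._ For small [mu <> 0] the map [F^q - p] moves some point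
    to the right and another one to the left; by monotonicity the first fact gives
    [q * rho >= p] and the second [q * rho <= p]
    ([rotation_number_locked_of_sign_change]).

    _Identification of [A] with [Psi]._ The pair of Fourier modes [n q] and
    [- n q] contributes twice the integral of [psi y * cos (2 pi n q (y - x))], so
    the partial sums of [Psi] are integrals of [psi] against the Dirichlet kernel
    at [q * (y - x)]. This kernel has period [1 / q], hence [psi] may be replaced by
    [A], which by Bezout has period [1 / q] as well; after a dilation by [q] these
    are the symmetric partial Fourier sums at [0] of the [C1] function
    [t |-> A (x + t / q)], which converge to [A x] by Dirichlet's theorem
    ([dirichlet_pointwise_convergence], [Psi_eq_birkhoff_average]).

    Since [rotation_number] is a choice of a limit, its existence
    ([rotation_number_exists]) is part of the argument. *)

(** * Periodic functions *)

Lemma periodic1_shift_Z (f : R -> R) (k : Z) (x : R) :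
  periodic1 f -> f (x + IZR k) = f x.
Proof.
  intros Hf.
  assert (Hnat : forall n y, f (y + INR n) = f y).
  { induction n as [|n IH]; intros y.
    - simpl; now rewrite Rplus_0_r.
    - rewrite S_INR, <- Rplus_assoc, Hf; apply IH. }
  destruct (Z_le_gt_dec 0 k) as [Hk|Hk].
  - rewrite <- (Z2Nat.id k Hk), <- INR_IZR_INZ; apply Hnat.
  - rewrite <- (Hnat (Z.to_nat (- k)) (x + IZR k)).
    f_equal; rewrite INR_IZR_INZ, Z2Nat.id by lia.
    rewrite opp_IZR; ring.
Qed.

Lemma exists_representative_in_unit_interval (x : R) :
  exists k : Z, 0 <= x + IZR k <= 1.
Proof.
  exists (- Zfloor x)%Z; rewrite opp_IZR.
  destruct (Zfloor_bound x); lra.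
Qed.

Lemma periodic1_bounded (f : R -> R) :
  periodic1 f -> (forall x, continuous f x) ->
  exists M, 0 <= M /\ forall x, Rabs (f x) <= M.
Proof.
  intros Hper Hcont.
  destruct (continuity_ab_maj (fun x => Rabs (f x)) 0 1) as [xM [HM _]].
  - lra.
  - intros c _; apply continuity_pt_filterlim.
    apply (continuous_comp f Rabs); [apply Hcont | apply continuous_Rabs].
  - exists (Rabs (f xM)); split; [apply Rabs_pos|].
    intros x; destruct (exists_representative_in_unit_interval x) as [k Hk].
    rewrite <- (periodic1_shift_Z f k x Hper); now apply HM.
Qed.

Lemma ex_RInt_cont (f : R -> R) (u v : R) :
  (forall x, continuous f x) -> ex_RInt f u v.
Proof.
  intros Hf; apply (ex_RInt_continuous (V := R_CompleteNormedModule)).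
  intros z _; apply Hf.
Qed.

(** The hypothesis and the conclusion are equations in [R] itself, not in the
    carrier of a complete normed module, so that [ring] and [field] apply. *)
Lemma RInt_ext_real (f g : R -> R) (u v : R) :
  (forall x, Rmin u v < x < Rmax u v -> f x = g x) -> RInt f u v = RInt g u v.
Proof. exact (RInt_ext f g u v). Qed.

Lemma RInt_Chasles_cont (f : R -> R) (u v w : R) :
  (forall x, continuous f x) -> RInt f u v + RInt f v w = RInt f u w.
Proof.
  intros Hf; apply (RInt_Chasles (V := R_CompleteNormedModule));
    now apply ex_RInt_cont.
Qed.

Lemma RInt_scal_cont (f : R -> R) (c u v : R) :
  (forall x, continuous f x) -> RInt (fun x => c * f x) u v = c * RInt f u v.
Proof.
  intros Hf; apply (RInt_scal (V := R_CompleteNormedModule) f).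
  now apply ex_RInt_cont.
Qed.

Lemma RInt_plus_cont (f g : R -> R) (u v : R) :
  (forall x, continuous f x) -> (forall x, continuous g x) ->
  RInt (fun x => f x + g x) u v = RInt f u v + RInt g u v.
Proof.
  intros Hf Hg; apply (RInt_plus (V := R_CompleteNormedModule) f g);
    now apply ex_RInt_cont.
Qed.

Lemma RInt_minus_cont (f g : R -> R) (u v : R) :
  (forall x, continuous f x) -> (forall x, continuous g x) ->
  RInt (fun x => f x - g x) u v = RInt f u v - RInt g u v.
Proof.
  intros Hf Hg; apply (RInt_minus (V := R_CompleteNormedModule) f g);
    now apply ex_RInt_cont.
Qed.

Lemma RInt_translate (f : R -> R) (c u v : R) :
  (forall x, continuous f x) ->
  RInt (fun x => f (x + c)) u v = RInt f (u + c) (v + c).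
Proof.
  intros Hf.
  assert (H := RInt_comp_lin (V := R_CompleteNormedModule) f 1 c u v
    (ex_RInt_cont f _ _ Hf)).
  rewrite !Rmult_1_l in H; rewrite <- H.
  apply RInt_ext; intros x _; unfold scal; simpl; unfold mult; simpl.
  now rewrite !Rmult_1_l.
Qed.

Lemma RInt_periodic1_window (f : R -> R) (c : R) :
  periodic1 f -> (forall x, continuous f x) ->
  RInt f c (c + 1) = RInt f 0 1.
Proof.
  intros Hper Hf.
  assert (H1 : RInt f (0 + 1) (c + 1) = RInt f 0 c).
  { rewrite <- RInt_translate by exact Hf.
    apply RInt_ext; intros x _; apply Hper. }
  rewrite Rplus_0_l in H1.
  assert (H2 := RInt_Chasles_cont f 0 c (c + 1) Hf).
  assert (H3 := RInt_Chasles_cont f 0 1 (c + 1) Hf).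
  lra.
Qed.

Lemma RInt_periodic1_translate (f : R -> R) (c : R) :
  periodic1 f -> (forall x, continuous f x) ->
  RInt (fun x => f (x + c)) 0 1 = RInt f 0 1.
Proof.
  intros Hper Hf; rewrite RInt_translate by exact Hf.
  rewrite Rplus_0_l, (Rplus_comm 1 c).
  now apply RInt_periodic1_window.
Qed.

Lemma RInt_periodic1_nat (f : R -> R) (n : nat) :
  periodic1 f -> (forall x, continuous f x) ->
  RInt f 0 (INR n) = INR n * RInt f 0 1.
Proof.
  intros Hper Hf; induction n as [|n IH].
  - simpl INR; rewrite RInt_point, Rmult_0_l; reflexivity.
  - rewrite S_INR.
    rewrite <- (RInt_Chasles_cont f 0 (INR n) (INR n + 1) Hf).
    rewrite RInt_periodic1_window, IH by assumption.
    change (INR n * RInt f 0 1 + RInt f 0 1 = (INR n + 1) * RInt f 0 1); ring.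
Qed.

Lemma Lipschitz_of_bounded_derivative (f f' : R -> R) (L : R) :
  (forall x, is_derive f x (f' x)) -> (forall x, Rabs (f' x) <= L) ->
  forall x y, Rabs (f y - f x) <= L * Rabs (y - x).
Proof.
  intros Hf Hb x y.
  destruct (MVT_gen f x y f') as [c [_ Hc]].
  - intros; apply Hf.
  - intros z _; apply continuity_pt_filterlim, (ex_derive_continuous (V := R_NormedModule)).
    now exists (f' z).
  - rewrite Hc, Rabs_mult.
    apply Rmult_le_compat_r; [apply Rabs_pos | apply Hb].
Qed.

Lemma C1_is_derive (f : R -> R) (x : R) : C1 f -> is_derive f x (Derive f x).
Proof. intros Hf; apply Derive_correct, Hf. Qed.

Lemma C1_continuous (f : R -> R) (x : R) : C1 f -> continuous f x.
Proof. intros Hf; apply (ex_derive_continuous (V := R_NormedModule)), Hf. Qed.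

Lemma Derive_periodic1 (f : R -> R) : periodic1 f -> periodic1 (Derive f).
Proof.
  intros Hf x; unfold Derive; f_equal; apply Lim_ext; intros h.
  replace (x + 1 + h) with (x + h + 1) by ring; now rewrite !Hf.
Qed.

Lemma C1_periodic_Lipschitz (f : R -> R) :
  C1 f -> periodic1 f ->
  exists L, 0 <= L /\ forall x y, Rabs (f y - f x) <= L * Rabs (y - x).
Proof.
  intros HC1 Hper.
  destruct (periodic1_bounded (Derive f)) as [L [HL Hb]].
  - now apply Derive_periodic1.
  - intros x; apply HC1.
  - exists L; split; [exact HL|].
    apply (Lipschitz_of_bounded_derivative f (Derive f)); [|exact Hb].
    intros x; now apply C1_is_derive.
Qed.

(** * Rotation numbers *)

Lemma is_lift_iter (F : R -> R) (n : nat) : is_lift F -> is_lift (Nat.iter n F).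
Proof.
  intros [Hc [Hm H1]]; induction n as [|n [IHc [IHm IH1]]].
  - split; [|split]; simpl; auto using continuous_id.
  - split; [|split]; simpl.
    + intros x; apply (continuous_comp (Nat.iter n F) F); auto.
    + intros x y Hxy; apply Hm, IHm, Hxy.
    + intros x; now rewrite IH1, H1.
Qed.

Lemma displacement_periodic1 (F : R -> R) :
  is_lift F -> periodic1 (fun x => F x - x).
Proof. intros [_ [_ H1]] x; rewrite H1; ring. Qed.

Lemma is_lift_shift_Z (F : R -> R) (k : Z) (x : R) :
  is_lift F -> F (x + IZR k) = F x + IZR k.
Proof.
  intros HF.
  assert (H := periodic1_shift_Z _ k x (displacement_periodic1 F HF)).
  simpl in H; lra.
Qed.

Lemma is_lift_le (F : R -> R) (x y : R) : is_lift F -> x <= y -> F x <= F y.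
Proof.
  intros [_ [Hm _]] [Hxy | ->]; [left; now apply Hm | now right].
Qed.

(** Monotonicity over one period forces this: moving [x] into
    [[y, y + 1)] by an integer does not change its displacement. *)
Lemma displacement_oscillation (F : R -> R) (x y : R) :
  is_lift F -> Rabs ((F x - x) - (F y - y)) <= 1.
Proof.
  intros HF; set (k := Zfloor (x - y)).
  destruct (Zfloor_bound (x - y)) as [Hk1 Hk2]; fold k in Hk1, Hk2.
  assert (H1 : F (y + IZR k) <= F x) by (apply is_lift_le; [easy | lra]).
  assert (H2 : F x <= F (y + IZR (k + 1))).
  { apply is_lift_le; [easy|]; rewrite plus_IZR; lra. }
  rewrite is_lift_shift_Z in H1, H2 by exact HF.
  rewrite plus_IZR in H2; apply Rabs_le; lra.
Qed.

Lemma quasi_additive_multiple (u : nat -> R) (m k : nat) :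
  (forall i j, Rabs (u (i + j)%nat - u i - u j) <= 1) ->
  Rabs (u (S k * m)%nat - INR (S k) * u m) <= INR k.
Proof.
  intros Hu; induction k as [|k IH].
  - replace (1 * m)%nat with m by lia; simpl INR.
    replace (u m - 1 * u m) with 0 by ring; rewrite Rabs_R0; lra.
  - replace (S (S k) * m)%nat with (m + S k * m)%nat by lia.
    apply Rabs_le; rewrite (S_INR (S k)), (S_INR k) in *.
    apply Rabs_le_between in IH.
    assert (H := Hu m (S k * m)%nat); apply Rabs_le_between in H; lra.
Qed.

(** Comparing [u (m * n)] with both [n * u m] and [m * u n] shows that the
    averages [u n / n] form a Cauchy sequence with gaps [1 / m + 1 / n]. *)
Lemma quasi_additive_average_converges (u : nat -> R) :
  (forall i j, Rabs (u (i + j)%nat - u i - u j) <= 1) ->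
  ex_finite_lim_seq (fun n => u n / INR n).
Proof.
  intros Hu.
  assert (Hgap : forall m n, Rabs (u (S m) / INR (S m) - u (S n) / INR (S n))
    <= / INR (S m) + / INR (S n)).
  { intros m n.
    assert (Hm := lt_0_INR (S m) (Nat.lt_0_succ m)).
    assert (Hn := lt_0_INR (S n) (Nat.lt_0_succ n)).
    assert (Em := quasi_additive_multiple u (S m) n Hu).
    assert (En := quasi_additive_multiple u (S n) m Hu).
    replace (S m * S n)%nat with (S n * S m)%nat in En by lia.
    assert (Hm' : INR m <= INR (S m)) by (rewrite S_INR; lra).
    assert (Hn' : INR n <= INR (S n)) by (rewrite S_INR; lra).
    apply Rabs_le_between in Em; apply Rabs_le_between in En.
    replace (u (S m) / INR (S m) - u (S n) / INR (S n))
      with ((INR (S n) * u (S m) - INR (S m) * u (S n)) * / (INR (S m) * INR (S n)))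
      by (field; lra).
    replace (/ INR (S m) + / INR (S n))
      with ((INR (S n) + INR (S m)) * / (INR (S m) * INR (S n))) by (field; lra).
    rewrite Rabs_mult, (Rabs_pos_eq (/ _))
      by (left; apply Rinv_0_lt_compat; nra).
    apply Rmult_le_compat_r; [left; apply Rinv_0_lt_compat; nra|].
    apply Rabs_le; lra. }
  apply ex_lim_seq_cauchy_corr; intros eps.
  assert (Heps := cond_pos eps).
  destruct (archimed_cor1 (eps / 2)) as [N [HN HN0]]; [lra|].
  exists N; intros m n Hm Hn.
  destruct m as [|m]; [lia|]; destruct n as [|n]; [lia|].
  assert (Hle : forall k, (N <= k)%nat -> / INR k <= / INR N).
  { intros k Hk; apply Rinv_le_contravar; [now apply lt_0_INR | now apply le_INR]. }
  assert (H1 := Hle _ Hm); assert (H2 := Hle _ Hn); assert (H3 := Hgap m n); lra.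
Qed.

(** Poincare's theorem: the sequence [F^n 0] is quasi-additive because the
    displacement of [F^i] oscillates by at most one. *)
Theorem rotation_number_exists (F : R -> R) :
  is_lift F -> exists r, is_rotation_number F r.
Proof.
  intros HF.
  destruct (quasi_additive_average_converges (fun n => Nat.iter n F 0)) as [r Hr].
  { intros i j; rewrite Nat.iter_add.
    assert (H := displacement_oscillation (Nat.iter i F) (Nat.iter j F 0) 0
      (is_lift_iter F i HF)).
    replace (Nat.iter i F (Nat.iter j F 0) - Nat.iter i F 0 - Nat.iter j F 0)
      with (Nat.iter i F (Nat.iter j F 0) - Nat.iter j F 0 - (Nat.iter i F 0 - 0))
      by ring; exact H. }
  exists r; intros x.
  apply is_lim_seq_ext with (fun n => Nat.iter n F 0 / INR n
    + ((Nat.iter n F x - x) - (Nat.iter n F 0 - 0)) * / INR n).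
  { intros n; unfold Rdiv; ring. }
  replace (Finite r) with (Finite (r + 0)) by (f_equal; ring).
  apply is_lim_seq_plus'; [exact Hr|].
  apply is_lim_seq_abs_0.
  apply is_lim_seq_le_le_loc with (fun _ => 0) (fun n => / INR n).
  - exists 1%nat; intros n Hn; split; [apply Rabs_pos|].
    assert (Hi : 0 < / INR n) by (apply Rinv_0_lt_compat, lt_0_INR; lia).
    rewrite Rabs_mult, (Rabs_pos_eq (/ INR n)) by lra.
    assert (H := displacement_oscillation (Nat.iter n F) x 0 (is_lift_iter F n HF)).
    nra.
  - apply is_lim_seq_const.
  - replace (Finite 0) with (Rbar_inv p_infty) by reflexivity.
    apply is_lim_seq_inv; [apply is_lim_seq_INR | easy].
Qed.

Lemma rotation_number_correct (F : R -> R) :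
  is_lift F -> is_rotation_number F (rotation_number F).
Proof.
  intros HF; destruct (rotation_number_exists F HF) as [r Hr].
  unfold rotation_number; apply (iota_correct (V := R_CompleteNormedModule)).
  exists r; split; [exact Hr|].
  intros r' Hr'; specialize (Hr 0); specialize (Hr' 0).
  apply is_lim_seq_unique in Hr; apply is_lim_seq_unique in Hr'.
  rewrite Hr in Hr'; now injection Hr'.
Qed.

Lemma rotation_number_along_multiples (F : R -> R) (Q : nat) (x : R) :
  is_lift F -> (0 < Q)%nat ->
  is_lim_seq (fun n => (Nat.iter n (Nat.iter Q F) x - x) / INR n)
    (INR Q * rotation_number F).
Proof.
  intros HF HQ.
  assert (Hit : forall n, Nat.iter n (Nat.iter Q F) x = Nat.iter (n * Q) F x).
  { induction n as [|n IH]; [easy|].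
    simpl; now rewrite IH, <- Nat.iter_add. }
  assert (HQ' := lt_0_INR Q HQ).
  apply is_lim_seq_ext_loc
    with (fun n => INR Q * ((Nat.iter (n * Q) F x - x) / INR (n * Q))).
  - exists 1%nat; intros n Hn; rewrite Hit, mult_INR.
    field; split; [apply not_0_INR; lia | lra].
  - apply (is_lim_seq_scal_l _ (INR Q) (Finite (rotation_number F))).
    apply (is_lim_seq_subseq (fun n => (Nat.iter n F x - x) / INR n) _
      (fun n => (n * Q)%nat)).
    + intros P [N HN]; exists N; intros n Hn; apply HN; nia.
    + now apply rotation_number_correct.
Qed.

Lemma is_lim_seq_affine_average (c B : R) :
  is_lim_seq (fun n => c + B * / INR n) c.
Proof.
  replace (Finite c) with (Finite (c + B * 0)) by (f_equal; ring).
  apply is_lim_seq_plus'; [apply is_lim_seq_const|].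
  apply (is_lim_seq_scal_l _ B (Finite 0)).
  replace (Finite 0) with (Rbar_inv p_infty) by reflexivity.
  apply is_lim_seq_inv; [apply is_lim_seq_INR | easy].
Qed.

Lemma rotation_number_upper_bound (F : R -> R) (Q : nat) (x c B : R) :
  is_lift F -> (0 < Q)%nat ->
  (forall n, Nat.iter n (Nat.iter Q F) x - x <= INR n * c + B) ->
  INR Q * rotation_number F <= c.
Proof.
  intros HF HQ Hb.
  refine (is_lim_seq_le_loc _ _ (Finite _) (Finite _) _
    (rotation_number_along_multiples F Q x HF HQ) (is_lim_seq_affine_average c B)).
  exists 1%nat; intros n Hn.
  assert (Hn' := lt_0_INR n Hn).
  replace (c + B * / INR n) with ((INR n * c + B) / INR n) by (field; lra).
  apply Rmult_le_compat_r; [left; now apply Rinv_0_lt_compat | apply Hb].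
Qed.

Lemma rotation_number_lower_bound (F : R -> R) (Q : nat) (x c B : R) :
  is_lift F -> (0 < Q)%nat ->
  (forall n, INR n * c - B <= Nat.iter n (Nat.iter Q F) x - x) ->
  c <= INR Q * rotation_number F.
Proof.
  intros HF HQ Hb.
  refine (is_lim_seq_le_loc _ _ (Finite _) (Finite _) _
    (is_lim_seq_affine_average c (- B)) (rotation_number_along_multiples F Q x HF HQ)).
  exists 1%nat; intros n Hn.
  assert (Hn' := lt_0_INR n Hn).
  replace (c + - B * / INR n) with ((INR n * c - B) / INR n) by (field; lra).
  apply Rmult_le_compat_r; [left; now apply Rinv_0_lt_compat | apply Hb].
Qed.

(** By monotonicity the inequality at the single point [x] propagates along
    the whole orbit of [x] under [F^Q]. *)
Lemma rotation_number_le_of_point (F : R -> R) (Q : nat) (p : Z) (x : R) :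
  is_lift F -> (0 < Q)%nat -> Nat.iter Q F x <= x + IZR p ->
  INR Q * rotation_number F <= IZR p.
Proof.
  intros HF HQ Hx; apply (rotation_number_upper_bound F Q x _ 0); auto.
  assert (HG := is_lift_iter F Q HF).
  induction n as [|n IH]; [simpl; lra|].
  rewrite S_INR; simpl.
  set (y := Nat.iter n (Nat.iter Q F) x) in *.
  assert (Hy : Nat.iter Q F y <= Nat.iter Q F (x + IZR (Z.of_nat n * p))).
  { apply is_lift_le; [easy|]; rewrite mult_IZR, <- INR_IZR_INZ; lra. }
  rewrite is_lift_shift_Z, mult_IZR, <- INR_IZR_INZ in Hy by exact HG; lra.
Qed.

Lemma rotation_number_ge_of_point (F : R -> R) (Q : nat) (p : Z) (x : R) :
  is_lift F -> (0 < Q)%nat -> x + IZR p <= Nat.iter Q F x ->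
  IZR p <= INR Q * rotation_number F.
Proof.
  intros HF HQ Hx; apply (rotation_number_lower_bound F Q x _ 0); auto.
  assert (HG := is_lift_iter F Q HF).
  induction n as [|n IH]; [simpl; lra|].
  rewrite S_INR; simpl.
  set (y := Nat.iter n (Nat.iter Q F) x) in *.
  assert (Hy : Nat.iter Q F (x + IZR (Z.of_nat n * p)) <= Nat.iter Q F y).
  { apply is_lift_le; [easy|]; rewrite mult_IZR, <- INR_IZR_INZ; lra. }
  rewrite is_lift_shift_Z, mult_IZR, <- INR_IZR_INZ in Hy by exact HG; lra.
Qed.

(** * Birkhoff sums over a rotation *)

Fixpoint birkhoff_sum (f : R -> R) (theta : R) (n : nat) (x : R) : R :=
  match n with
  | O => 0
  | S k => birkhoff_sum f theta k x + f (x + INR k * theta)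
  end.

Definition birkhoff_average (f : R -> R) (theta : R) (n : nat) (x : R) : R :=
  birkhoff_sum f theta n x / INR n.

Lemma birkhoff_sum_bound (f : R -> R) (theta M : R) (n : nat) (x : R) :
  (forall y, Rabs (f y) <= M) -> Rabs (birkhoff_sum f theta n x) <= INR n * M.
Proof.
  intros Hf; induction n as [|n IH].
  - simpl; rewrite Rabs_R0; lra.
  - rewrite S_INR; simpl.
    eapply Rle_trans; [apply Rabs_triang|].
    specialize (Hf (x + INR n * theta)); lra.
Qed.

Lemma birkhoff_sum_continuous (f : R -> R) (theta : R) (n : nat) (x : R) :
  (forall y, continuous f y) -> continuous (birkhoff_sum f theta n) x.
Proof.
  intros Hf; induction n as [|n IH]; simpl.
  - apply continuous_const.
  - apply (continuous_plus (birkhoff_sum f theta n)); [exact IH|].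
    apply (continuous_comp (fun y => y + INR n * theta) f); [|apply Hf].
    apply (continuous_plus (V := R_NormedModule) (fun y : R => y)
      (fun _ => INR n * theta)); [apply continuous_id | apply continuous_const].
Qed.

Lemma birkhoff_sum_is_derive (f f' : R -> R) (theta : R) (n : nat) (x : R) :
  (forall y, is_derive f y (f' y)) ->
  is_derive (birkhoff_sum f theta n) x (birkhoff_sum f' theta n x).
Proof.
  intros Hf; induction n as [|n IH]; simpl.
  - apply (is_derive_const (V := R_NormedModule)).
  - apply (is_derive_plus (birkhoff_sum f theta n)); [exact IH|].
    replace (f' (x + INR n * theta)) with (scal 1 (f' (x + INR n * theta)))
      by apply Rmult_1_l.
    apply (is_derive_comp f (fun y => y + INR n * theta)); [apply Hf|].
    auto_derive; [easy | ring].
Qed.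

Lemma birkhoff_average_C1 (f : R -> R) (theta : R) (n : nat) :
  C1 f -> C1 (birkhoff_average f theta n).
Proof.
  intros Hf.
  assert (Hd : forall x, is_derive (birkhoff_average f theta n) x
    (birkhoff_average (Derive f) theta n x)).
  { intros x; unfold birkhoff_average, Rdiv.
    apply is_derive_ext with (fun t => scal (/ INR n) (birkhoff_sum f theta n t)).
    { intros t; apply Rmult_comm. }
    rewrite (Rmult_comm _ (/ INR n)).
    apply (is_derive_scal (birkhoff_sum f theta n) x).
    apply birkhoff_sum_is_derive; intros y; now apply C1_is_derive. }
  intros x; split; [now eexists|].
  apply continuous_ext with (birkhoff_average (Derive f) theta n).
  { intros y; symmetry; apply is_derive_unique, Hd. }
  apply (continuous_mult (birkhoff_sum (Derive f) theta n)).
  - apply birkhoff_sum_continuous; intros y; apply Hf.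
  - apply continuous_const.
Qed.

Lemma birkhoff_average_periodic1 (f : R -> R) (theta : R) (n : nat) :
  periodic1 f -> periodic1 (birkhoff_average f theta n).
Proof.
  intros Hf x; unfold birkhoff_average; f_equal.
  induction n as [|n IH]; [easy|]; simpl; rewrite IH; f_equal.
  replace (x + 1 + INR n * theta) with (x + INR n * theta + 1) by ring; apply Hf.
Qed.

Lemma birkhoff_sum_shift (f : R -> R) (theta : R) (n : nat) (x : R) :
  birkhoff_sum f theta n (x + theta) + f x
  = birkhoff_sum f theta n x + f (x + INR n * theta).
Proof.
  induction n as [|n IH]; simpl.
  - f_equal; f_equal; ring.
  - rewrite <- IH; replace (x + theta + INR n * theta) with (x + INR (S n) * theta)
      by (rewrite S_INR; ring).
    simpl; ring.
Qed.

(** The average over a rotation by [p / q] is invariant under that rotation as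
    well as under [1]; by Bezout these two translations generate [1 / q]. *)
Lemma birkhoff_average_period_inv_q (f : R -> R) (p q : Z) (x : R) :
  periodic1 f -> (1 <= q)%Z -> rel_prime p q ->
  let A := birkhoff_average f (IZR p / IZR q) (Z.to_nat q) in
  A (x + / IZR q) = A x.
Proof.
  intros Hf Hq Hpq A.
  assert (HqR : 1 <= IZR q) by now apply IZR_le.
  assert (Hrot : forall y, A (y + IZR p / IZR q) = A y).
  { intros y; unfold A, birkhoff_average; f_equal.
    assert (H := birkhoff_sum_shift f (IZR p / IZR q) (Z.to_nat q) y).
    replace (INR (Z.to_nat q) * (IZR p / IZR q)) with (IZR p) in H.
    - rewrite periodic1_shift_Z in H by exact Hf; lra.
    - rewrite INR_IZR_INZ, Z2Nat.id by lia; field; lra. }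
  (* Measured in units of [p / q], iterated rotation becomes an integer shift. *)
  set (B := fun t => A (t * (IZR p / IZR q))).
  assert (HB : periodic1 B).
  { intros t; unfold B; rewrite Rmult_plus_distr_r, Rmult_1_l; apply Hrot. }
  destruct (rel_prime_bezout p q Hpq) as [u v Huv].
  replace (x + / IZR q) with (x + IZR u * (IZR p / IZR q) + IZR v).
  - rewrite periodic1_shift_Z by now apply birkhoff_average_periodic1.
    destruct (Z.eq_dec p 0) as [->|Hp].
    + f_equal; unfold Rdiv; ring.
    + assert (HpR : IZR p <> 0) by now apply not_0_IZR.
      assert (H := periodic1_shift_Z B u (x / (IZR p / IZR q)) HB).
      unfold B in H.
      replace ((x / (IZR p / IZR q) + IZR u) * (IZR p / IZR q))
        with (x + IZR u * (IZR p / IZR q)) in H by (field; lra).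
      replace (x / (IZR p / IZR q) * (IZR p / IZR q)) with x in H by (field; lra).
      exact H.
  - assert (HuvR : IZR u * IZR p + IZR v * IZR q = 1).
    { rewrite <- !mult_IZR, <- plus_IZR; now f_equal. }
    rewrite Rplus_assoc; f_equal.
    apply Rmult_eq_reg_r with (IZR q); [|lra].
    field_simplify; lra.
Qed.

(** * First-order expansion of the iterates *)

(** Up to [O(mu)] the orbit of [x] is the orbit of the rotation by [p / q], so
    that, [psi] being Lipschitz, the terms of order [mu] add up to the Birkhoff
    sum of [a + psi] with an error [O(mu ^ 2)], uniform in [x]. *)
Lemma class_R_iterate_expansion (p q : Z) (F : R -> R -> R) (mu0 a : R)
    (psi : R -> R) (g : R -> R -> R) (n : nat) :
  class_R p q F mu0 a psi g ->
  exists C, 0 <= C /\ forall x mu, Rabs mu < mu0 -> Rabs mu <= 1 ->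
    Rabs (Nat.iter n (fun y => F y mu) x
      - (x + INR n * (IZR p / IZR q)
         + mu * (INR n * a + birkhoff_sum psi (IZR p / IZR q) n x)))
    <= C * mu ^ 2.
Proof.
  intros [_ _ _ Hform HC1 Hper _ [M HM] _ _ _].
  destruct (C1_periodic_Lipschitz psi HC1 Hper) as [L [HL HLip]].
  destruct (periodic1_bounded psi Hper) as [K [HK HKb]].
  { intros x; now apply C1_continuous. }
  set (theta := IZR p / IZR q) in *.
  assert (HMpos : 0 <= Rmax M 0) by apply Rmax_r.
  assert (HMM : M <= Rmax M 0) by apply Rmax_l.
  set (M' := Rmax M 0) in *.
  induction n as [|n [C [HC IH]]].
  - exists 0; split; [lra|]; intros x mu _ _; simpl.
    replace (x - _) with 0 by ring; rewrite Rabs_R0; lra.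
  - assert (Hn := pos_INR n).
    assert (Ha := Rabs_pos a).
    (* [D * |mu|] bounds the distance to the orbit of the rotation. *)
    set (D := INR n * (Rabs a + K) + C).
    assert (HD : 0 <= D) by (unfold D; nra).
    exists (C + L * D + M'); split; [nra|].
    intros x mu Hmu0 Hmu1.
    specialize (IH x mu Hmu0 Hmu1).
    specialize (HM (Nat.iter n (fun y => F y mu) x) mu Hmu0).
    assert (HS := birkhoff_sum_bound psi theta K n x HKb).
    simpl Nat.iter; rewrite (Hform _ _ Hmu0), S_INR; simpl birkhoff_sum.
    set (y := Nat.iter n (fun y => F y mu) x) in *.
    set (S := birkhoff_sum psi theta n x) in *.
    assert (Hmu := Rabs_pos mu).
    assert (Hsq : mu ^ 2 = Rabs mu * Rabs mu) by (rewrite <- Rabs_mult, Rabs_pos_eq; nra).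
    assert (Hclose : Rabs (y - (x + INR n * theta)) <= D * Rabs mu).
    { replace (y - (x + INR n * theta))
        with ((y - (x + INR n * theta + mu * (INR n * a + S))) + mu * (INR n * a + S))
        by ring.
      eapply Rle_trans; [apply Rabs_triang|]; rewrite Rabs_mult.
      assert (H : Rabs (INR n * a + S) <= INR n * (Rabs a + K)).
      { eapply Rle_trans; [apply Rabs_triang|].
        rewrite Rabs_mult, (Rabs_pos_eq (INR n)) by exact Hn; lra. }
      unfold D; rewrite Hsq in IH.
      assert (C * (Rabs mu * Rabs mu) <= C * Rabs mu) by (apply Rmult_le_compat_l; nra).
      assert (Rabs mu * Rabs (INR n * a + S) <= Rabs mu * (INR n * (Rabs a + K)))
        by now apply Rmult_le_compat_l.
      lra. }
    assert (Hpsi : Rabs (psi y - psi (x + INR n * theta)) <= L * D * Rabs mu).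
    { eapply Rle_trans; [apply HLip|].
      rewrite Rmult_assoc; now apply Rmult_le_compat_l. }
    replace (y + theta + mu * (a + psi y) + mu ^ 2 * g y mu - _)
      with ((y - (x + INR n * theta + mu * (INR n * a + S)))
            + mu * (psi y - psi (x + INR n * theta)) + mu ^ 2 * g y mu) by ring.
    eapply Rle_trans; [apply Rabs_triang|].
    assert (H1 : Rabs (mu ^ 2 * g y mu) <= mu ^ 2 * M').
    { rewrite Rabs_mult, (Rabs_pos_eq (mu ^ 2)) by nra.
      apply Rmult_le_compat_l; [nra | lra]. }
    assert (H2 : Rabs (mu * (psi y - psi (x + INR n * theta))) <= L * D * mu ^ 2).
    { rewrite Rabs_mult, Hsq.
      replace (L * D * (Rabs mu * Rabs mu)) with (Rabs mu * (L * D * Rabs mu)) by ring.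
      now apply Rmult_le_compat_l. }
    assert (H3 := Rabs_triang (y - (x + INR n * theta + mu * (INR n * a + S)))
      (mu * (psi y - psi (x + INR n * theta)))).
    lra.
Qed.

(** For [n = q] the rotation part of the expansion is the integer [p]. *)
Lemma class_R_return_map_expansion (p q : Z) (F : R -> R -> R) (mu0 a : R)
    (psi : R -> R) (g : R -> R -> R) :
  (1 <= q)%Z -> class_R p q F mu0 a psi g ->
  let Q := Z.to_nat q in
  let f := fun x => a + birkhoff_average psi (IZR p / IZR q) Q x in
  exists C, 0 <= C /\ forall x mu, Rabs mu < mu0 -> Rabs mu <= 1 ->
    Rabs (Nat.iter Q (fun y => F y mu) x - (x + IZR p + mu * INR Q * f x))
    <= C * mu ^ 2.
Proof.
  intros Hq HF Q f.
  destruct (class_R_iterate_expansion p q F mu0 a psi g Q HF) as [C [HC H]].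
  exists C; split; [exact HC|]; intros x mu H0 H1.
  specialize (H x mu H0 H1).
  assert (HQ : INR Q = IZR q) by (unfold Q; rewrite INR_IZR_INZ, Z2Nat.id; [easy | lia]).
  assert (HqR : 1 <= IZR q) by now apply IZR_le.
  unfold f, birkhoff_average.
  replace (x + IZR p + mu * INR Q * _)
    with (x + INR Q * (IZR p / IZR q)
      + mu * (INR Q * a + birkhoff_sum psi (IZR p / IZR q) Q x)); [exact H|].
  rewrite HQ; field; lra.
Qed.

(** * Maps close to the flow of a positive vector field *)

Lemma inv_field_continuous (f : R -> R) (m : R) :
  (forall x, continuous f x) -> 0 < m -> (forall x, m <= f x) ->
  forall x, continuous (fun y => 1 / f y) x.
Proof.
  intros Hf Hm Hfm x; unfold Rdiv.
  apply continuous_ext with (fun y => / f y); [intros y; now rewrite Rmult_1_l|].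
  apply continuous_comp; [apply Hf | apply continuous_Rinv].
  specialize (Hfm x); lra.
Qed.

(** The time [travel_time f x] needed to go from [0] to [x] along the vector
    field [f]; it conjugates the flow of [f] to translations. *)
Definition travel_time (f : R -> R) (x : R) : R := RInt (fun y => 1 / f y) 0 x.

Lemma travel_time_is_derive (f : R -> R) (m : R) :
  (forall x, continuous f x) -> 0 < m -> (forall x, m <= f x) ->
  forall x, is_derive (travel_time f) x (1 / f x).
Proof.
  intros Hf Hm Hfm x; unfold travel_time.
  assert (Hc := inv_field_continuous f m Hf Hm Hfm).
  apply (is_derive_RInt (fun y => 1 / f y) _ 0 x); [|apply Hc].
  apply filter_forall; intros b.
  now apply (RInt_correct (V := R_CompleteNormedModule)), ex_RInt_cont.
Qed.

Lemma travel_time_defect_periodic1 (f : R -> R) (m : R) :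
  (forall x, continuous f x) -> 0 < m -> (forall x, m <= f x) -> periodic1 f ->
  periodic1 (fun x => travel_time f x - travel_time f 1 * x).
Proof.
  intros Hf Hm Hfm Hper x; assert (Hc := inv_field_continuous f m Hf Hm Hfm).
  assert (H := RInt_Chasles_cont _ 0 x (x + 1) Hc).
  rewrite RInt_periodic1_window in H; [| |exact Hc].
  - change (travel_time f x + travel_time f 1 = travel_time f (x + 1)) in H; lra.
  - intros y; now rewrite Hper.
Qed.

Lemma travel_time_near_linear (f : R -> R) (m : R) :
  (forall x, continuous f x) -> 0 < m -> (forall x, m <= f x) -> periodic1 f ->
  exists B, 0 <= B /\ forall x, Rabs (travel_time f x - travel_time f 1 * x) <= B.
Proof.
  intros Hf Hm Hfm Hper.
  apply (periodic1_bounded (fun x => travel_time f x - travel_time f 1 * x)).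
  - now apply (travel_time_defect_periodic1 f m).
  - intros x; apply (ex_derive_continuous (V := R_NormedModule)).
    exists (1 / f x - travel_time f 1).
    apply (is_derive_minus (travel_time f)).
    + now apply (travel_time_is_derive f m).
    + auto_derive; [easy | ring].
Qed.

Lemma travel_time_shift_Z (f : R -> R) (m : R) (k : Z) (x : R) :
  (forall x, continuous f x) -> 0 < m -> (forall x, m <= f x) -> periodic1 f ->
  travel_time f (x + IZR k) = travel_time f x + IZR k * travel_time f 1.
Proof.
  intros Hf Hm Hfm Hper.
  assert (H := periodic1_shift_Z _ k x
    (travel_time_defect_periodic1 f m Hf Hm Hfm Hper)).
  simpl in H; lra.
Qed.

Lemma travel_time_period_pos (f : R -> R) (m : R) :
  (forall x, continuous f x) -> 0 < m -> (forall x, m <= f x) ->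
  0 < travel_time f 1.
Proof.
  intros Hf Hm Hfm; assert (Hc := inv_field_continuous f m Hf Hm Hfm).
  apply RInt_gt_0; [lra | | intros; apply Hc].
  intros x _; specialize (Hfm x); apply Rdiv_lt_0_compat; lra.
Qed.

(** The mean value theorem, and [1 / f] being Lipschitz with constant
    [L / m ^ 2]. *)
Lemma travel_time_first_order (f : R -> R) (m L : R) :
  (forall x, continuous f x) -> 0 < m -> (forall x, m <= f x) ->
  (forall x y, Rabs (f y - f x) <= L * Rabs (y - x)) ->
  forall x y, Rabs (travel_time f y - travel_time f x - (y - x) / f x)
    <= L / m ^ 2 * (y - x) ^ 2.
Proof.
  intros Hf Hm Hfm HL x y.
  assert (Hd := travel_time_is_derive f m Hf Hm Hfm).
  destruct (MVT_gen (travel_time f) x y (fun z => 1 / f z)) as [c [Hcxy Hc]].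
  - intros; apply Hd.
  - intros z _; apply continuity_pt_filterlim, (ex_derive_continuous (V := R_NormedModule)).
    now exists (1 / f z).
  - rewrite Hc.
    assert (Hx := Hfm x); assert (Hfc := Hfm c).
    replace (1 / f c * (y - x) - (y - x) / f x)
      with ((f x - f c) * (y - x) * / (f c * f x)) by (field; lra).
    rewrite !Rabs_mult, (Rabs_minus_sym (f x)).
    assert (Hcx : Rabs (c - x) <= Rabs (y - x)).
    { unfold Rmin, Rmax in Hcxy; destruct (Rle_dec x y);
        [rewrite !Rabs_pos_eq | rewrite !Rabs_left1]; lra. }
    assert (H0 := Rabs_pos (y - x)).
    assert (H1 := Rabs_pos (f c - f x)).
    assert (HLc := HL x c).
    assert (HL0 : 0 <= L).
    { specialize (HL 0 1); replace (1 - 0) with 1 in HL by ring.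
      rewrite Rabs_R1 in HL; assert (H := Rabs_pos (f 1 - f 0)); lra. }
    assert (H2 : Rabs (f c - f x) <= L * Rabs (y - x)).
    { eapply Rle_trans; [exact HLc|]; now apply Rmult_le_compat_l. }
    assert (Hi : Rabs (/ (f c * f x)) <= / m ^ 2).
    { rewrite Rabs_pos_eq by (left; apply Rinv_0_lt_compat; nra).
      apply Rinv_le_contravar; nra. }
    replace (L / m ^ 2 * (y - x) ^ 2)
      with (L * Rabs (y - x) * Rabs (y - x) * / m ^ 2)
      by (rewrite <- (pow2_abs (y - x)); unfold Rdiv; ring).
    apply Rmult_le_compat; [nra | apply Rabs_pos | | exact Hi].
    now apply Rmult_le_compat_r.
Qed.

(** In the coordinate [travel_time f] the map [F^Q - p] is the translation by
    [eps] up to the error [e]; adding up along an orbit of [F^Q] and dividing by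
    the number of steps leaves the error [e], since [travel_time f] is at bounded
    distance from the linear map with slope [travel_time f 1]. *)
Lemma rotation_number_of_near_translation (F : R -> R) (Q : nat) (p : Z)
    (f : R -> R) (m eps e : R) :
  is_lift F -> (0 < Q)%nat ->
  (forall x, continuous f x) -> 0 < m -> (forall x, m <= f x) -> periodic1 f ->
  (forall x, Rabs (travel_time f (Nat.iter Q F x - IZR p)
                   - travel_time f x - eps) <= e) ->
  Rabs (travel_time f 1 * (INR Q * rotation_number F - IZR p) - eps) <= e.
Proof.
  intros HF HQ Hf Hm Hfm Hper He.
  assert (HT := travel_time_period_pos f m Hf Hm Hfm).
  destruct (travel_time_near_linear f m Hf Hm Hfm Hper) as [B [HB HBb]].
  set (T := travel_time f 1) in *.
  assert (Horbit : forall n,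
    Rabs (travel_time f (Nat.iter n (Nat.iter Q F) 0) - travel_time f 0
      - INR n * (IZR p * T + eps)) <= INR n * e).
  { induction n as [|n IH].
    - simpl; replace (_ - _) with 0 by ring; rewrite Rabs_R0; lra.
    - rewrite S_INR; simpl Nat.iter.
      set (y := Nat.iter n (Nat.iter Q F) 0) in *.
      specialize (He y).
      assert (Hs := travel_time_shift_Z f m p (Nat.iter Q F y - IZR p) Hf Hm Hfm Hper).
      replace (Nat.iter Q F y - IZR p + IZR p) with (Nat.iter Q F y) in Hs by ring.
      fold T in Hs; rewrite Hs.
      apply Rabs_le_between in He; apply Rabs_le_between in IH.
      apply Rabs_le; lra. }
  assert (Hlin : forall n,
    Rabs (Nat.iter n (Nat.iter Q F) 0 - 0 - INR n * (IZR p + eps / T))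
    <= INR n * (e / T) + 2 * B / T).
  { intros n; specialize (Horbit n).
    set (y := Nat.iter n (Nat.iter Q F) 0) in *.
    assert (H0 := HBb 0); assert (Hy := HBb y).
    apply Rabs_le_between in H0; apply Rabs_le_between in Hy.
    apply Rabs_le_between in Horbit.
    replace (y - 0 - INR n * (IZR p + eps / T))
      with ((T * y - INR n * (IZR p * T + eps)) / T) by (field; lra).
    replace (INR n * (e / T) + 2 * B / T) with ((INR n * e + 2 * B) / T) by (field; lra).
    unfold Rdiv; rewrite Rabs_mult, (Rabs_pos_eq (/ T))
      by (left; now apply Rinv_0_lt_compat).
    apply Rmult_le_compat_r; [left; now apply Rinv_0_lt_compat|].
    apply Rabs_le; lra. }
  assert (Hup : INR Q * rotation_number F <= IZR p + eps / T + e / T).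
  { apply (rotation_number_upper_bound F Q 0 _ (2 * B / T)); auto.
    intros n; specialize (Hlin n); apply Rabs_le_between in Hlin; lra. }
  assert (Hlo : IZR p + eps / T - e / T <= INR Q * rotation_number F).
  { apply (rotation_number_lower_bound F Q 0 _ (2 * B / T)); auto.
    intros n; specialize (Hlin n); apply Rabs_le_between in Hlin; lra. }
  replace eps with (T * (eps / T)) by (field; lra).
  replace e with (T * (e / T)) by (field; lra).
  apply Rabs_le; split; nra.
Qed.

Lemma is_derive_of_quadratic_error (phi : R -> R) (c l C r : R) :
  0 < r -> 0 <= C ->
  (forall h, Rabs h < r -> Rabs (phi h - c - l * h) <= C * h ^ 2) ->
  is_derive phi 0 l.
Proof.
  intros Hr HC H.
  assert (H0 : phi 0 = c).
  { assert (H0 := H 0); rewrite Rabs_R0 in H0; specialize (H0 Hr).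
    replace (C * 0 ^ 2) with 0 in H0 by ring.
    apply Rabs_le_between in H0; lra. }
  apply is_derive_Reals; intros eps Heps.
  assert (Hd : 0 < Rmin r (eps / (C + 1))).
  { apply Rmin_glb_lt; [exact Hr|]; apply Rdiv_lt_0_compat; lra. }
  exists (mkposreal _ Hd); intros h Hh Hhd; simpl in Hhd.
  assert (Hr' := Rmin_l r (eps / (C + 1))); assert (He' := Rmin_r r (eps / (C + 1))).
  specialize (H h ltac:(lra)).
  assert (Hhpos := Rabs_pos_lt h Hh).
  rewrite Rplus_0_l, H0.
  replace ((phi h - c) / h - l) with ((phi h - c - l * h) * / h) by (field; exact Hh).
  rewrite Rabs_mult, Rabs_inv.
  apply Rle_lt_trans with (C * Rabs h).
  - replace (C * Rabs h) with (C * h ^ 2 * / Rabs h).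
    + apply Rmult_le_compat_r; [left; now apply Rinv_0_lt_compat | exact H].
    + rewrite <- pow2_abs; field; lra.
  - apply Rle_lt_trans with ((C + 1) * Rabs h); [nra|].
    apply Rlt_le_trans with ((C + 1) * (eps / (C + 1))).
    + apply Rmult_lt_compat_l; lra.
    + right; field; lra.
Qed.

(** * The two regimes of the averaged field *)

(** The travel time turns the step [mu * q * f x + O(mu ^ 2)] of the return map
    into [mu * q + O(mu ^ 2)], because the derivative [1 / f] of the travel time is
    Lipschitz. *)
Lemma rotation_number_derivative_positive_field (p q : Z) (F : R -> R -> R)
    (mu0 a : R) (psi : R -> R) (g : R -> R -> R) (m : R) :
  (1 <= q)%Z -> class_R p q F mu0 a psi g ->
  let f := fun x => a + birkhoff_average psi (IZR p / IZR q) (Z.to_nat q) x in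
  0 < m -> (forall x, m <= f x) ->
  is_derive (fun mu => rotation_number (fun x => F x mu)) 0
    (/ RInt (fun x => 1 / f x) 0 1).
Proof.
  intros Hq HF f Hm Hfm.
  destruct (class_R_return_map_expansion p q F mu0 a psi g Hq HF) as [C [HC Hexp]].
  set (Q := Z.to_nat q) in *.
  change (forall x mu, Rabs mu < mu0 -> Rabs mu <= 1 ->
    Rabs (Nat.iter Q (fun y => F y mu) x - (x + IZR p + mu * INR Q * f x))
    <= C * mu ^ 2) in Hexp.
  assert (HQ : INR Q = IZR q) by (unfold Q; rewrite INR_IZR_INZ, Z2Nat.id; [easy | lia]).
  assert (HQR : 1 <= INR Q) by (rewrite HQ; now apply IZR_le).
  assert (HQn : (0 < Q)%nat) by (unfold Q; lia).
  assert (HAC1 := birkhoff_average_C1 psi (IZR p / IZR q) Q (class_R_psi_C1 _ _ _ _ _ _ _ HF)).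
  assert (HAper := birkhoff_average_periodic1 psi (IZR p / IZR q) Q
    (class_R_psi_periodic _ _ _ _ _ _ _ HF)).
  assert (Hfper : periodic1 f) by (intros x; unfold f; now rewrite HAper).
  assert (Hfc : forall x, continuous f x).
  { intros x; apply (continuous_plus (fun _ => a)); [apply continuous_const|].
    now apply C1_continuous. }
  destruct (C1_periodic_Lipschitz _ HAC1 HAper) as [L [HL HLip]].
  assert (HfLip : forall x y, Rabs (f y - f x) <= L * Rabs (y - x)).
  { intros x y; unfold f.
    replace (_ - _) with (birkhoff_average psi (IZR p / IZR q) Q y
      - birkhoff_average psi (IZR p / IZR q) Q x) by ring; apply HLip. }
  destruct (periodic1_bounded f Hfper Hfc) as [K [HK HKb]].
  assert (HT := travel_time_period_pos f m Hfc Hm Hfm).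
  change (RInt (fun x => 1 / f x) 0 1) with (travel_time f 1).
  set (T := travel_time f 1) in *.
  (* [D * |mu|] bounds the displacement of the return map, and [E * mu ^ 2] the
     error in travel time. *)
  set (D := INR Q * K + C).
  assert (HD : 0 <= D) by (unfold D; nra).
  set (E := C / m + L / m ^ 2 * D ^ 2).
  assert (HLm : 0 <= L / m ^ 2) by
    (apply Rmult_le_pos; [easy | left; apply Rinv_0_lt_compat; nra]).
  assert (HE : 0 <= E).
  { unfold E; apply Rplus_le_le_0_compat; [|nra].
    apply Rmult_le_pos; [easy | left; now apply Rinv_0_lt_compat]. }
  assert (Hmu0 := class_R_mu0 _ _ _ _ _ _ _ HF).
  apply is_derive_of_quadratic_error
    with (c := IZR p / IZR q) (C := E / (T * INR Q)) (r := Rmin mu0 1).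
  { apply Rmin_glb_lt; lra. }
  { apply Rmult_le_pos; [easy | left; apply Rinv_0_lt_compat; nra]. }
  intros mu Hmu.
  assert (Hr1 := Rmin_l mu0 1); assert (Hr2 := Rmin_r mu0 1).
  assert (Hmu1 : Rabs mu < mu0) by lra; assert (Hmu2 : Rabs mu <= 1) by lra.
  assert (Hrot : Rabs (T * (INR Q * rotation_number (fun x => F x mu) - IZR p)
    - mu * INR Q) <= E * mu ^ 2).
  { apply (rotation_number_of_near_translation _ Q p f m); auto.
    { now apply (class_R_lift _ _ _ _ _ _ _ HF). }
    intros x; specialize (Hexp x mu Hmu1 Hmu2).
    set (y := Nat.iter Q (fun x0 => F x0 mu) x) in *.
    assert (H1 := travel_time_first_order f m L Hfc Hm Hfm HfLip x (y - IZR p)).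
    set (r := y - (x + IZR p + mu * INR Q * f x)) in *.
    replace (y - IZR p - x) with (mu * INR Q * f x + r) in H1 by (unfold r; ring).
    assert (Hfx := Hfm x).
    replace ((mu * INR Q * f x + r) / f x) with (mu * INR Q + r / f x) in H1
      by (field; lra).
    assert (Hr : Rabs (r / f x) <= C / m * mu ^ 2).
    { unfold Rdiv; rewrite Rabs_mult.
      replace (C * / m * mu ^ 2) with (C * mu ^ 2 * / m) by ring.
      apply Rmult_le_compat; try apply Rabs_pos; [exact Hexp|].
      rewrite Rabs_pos_eq by (left; apply Rinv_0_lt_compat; lra).
      apply Rinv_le_contravar; lra. }
    assert (Hstep : (mu * INR Q * f x + r) ^ 2 <= D ^ 2 * mu ^ 2).
    { assert (Hmua := Rabs_pos mu).
      assert (Hsq : mu ^ 2 = Rabs mu * Rabs mu)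
        by (rewrite <- Rabs_mult, Rabs_pos_eq; nra).
      assert (H2 : Rabs (mu * INR Q * f x + r) <= D * Rabs mu).
      { eapply Rle_trans; [apply Rabs_triang|].
        rewrite !Rabs_mult, (Rabs_pos_eq (INR Q)) by lra.
        assert (Rabs mu * INR Q * Rabs (f x) <= Rabs mu * INR Q * K).
        { apply Rmult_le_compat_l; [nra | apply HKb]. }
        assert (C * mu ^ 2 <= C * Rabs mu) by (rewrite Hsq; apply Rmult_le_compat_l; nra).
        unfold D; lra. }
      rewrite <- (pow2_abs (_ + _)), Hsq.
      replace (D ^ 2 * (Rabs mu * Rabs mu)) with ((D * Rabs mu) ^ 2) by ring.
      apply pow_incr; split; [apply Rabs_pos | exact H2]. }
    assert (H3 : L / m ^ 2 * (mu * INR Q * f x + r) ^ 2 <= L / m ^ 2 * (D ^ 2 * mu ^ 2))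
      by now apply Rmult_le_compat_l.
    unfold E; apply Rabs_le_between in H1; apply Rabs_le_between in Hr.
    apply Rabs_le; lra. }
  rewrite <- HQ.
  set (rho := rotation_number _) in *.
  replace (rho - IZR p / INR Q - / T * mu)
    with ((T * (INR Q * rho - IZR p) - mu * INR Q) * / (T * INR Q)) by (field; lra).
  replace (E / (T * INR Q) * mu ^ 2) with (E * mu ^ 2 * / (T * INR Q)) by (field; lra).
  assert (Hi : 0 < / (T * INR Q)) by (apply Rinv_0_lt_compat; nra).
  rewrite Rabs_mult, (Rabs_pos_eq (/ _)) by lra.
  apply Rmult_le_compat_r; lra.
Qed.

(** For small [mu <> 0] the return map minus [p] moves a point where the field
    is negative and a point where it is positive in opposite directions. *)
Lemma rotation_number_locked_of_sign_change (p q : Z) (F : R -> R -> R)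
    (mu0 a : R) (psi : R -> R) (g : R -> R -> R) (x1 x2 : R) :
  (1 <= q)%Z -> class_R p q F mu0 a psi g ->
  let f := fun x => a + birkhoff_average psi (IZR p / IZR q) (Z.to_nat q) x in
  f x1 < 0 -> 0 < f x2 ->
  exists mu1, 0 < mu1 < mu0 /\ forall mu, Rabs mu < mu1 ->
    rotation_number (fun x => F x mu) = IZR p / IZR q.
Proof.
  intros Hq HF f H1 H2.
  destruct (class_R_return_map_expansion p q F mu0 a psi g Hq HF) as [C [HC Hexp]].
  set (Q := Z.to_nat q) in *.
  change (forall x mu, Rabs mu < mu0 -> Rabs mu <= 1 ->
    Rabs (Nat.iter Q (fun y => F y mu) x - (x + IZR p + mu * INR Q * f x))
    <= C * mu ^ 2) in Hexp.
  assert (HQ : INR Q = IZR q) by (unfold Q; rewrite INR_IZR_INZ, Z2Nat.id; [easy | lia]).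
  assert (HQR : 1 <= INR Q) by (rewrite HQ; now apply IZR_le).
  assert (HQn : (0 < Q)%nat) by (unfold Q; lia).
  assert (Hmu0 := class_R_mu0 _ _ _ _ _ _ _ HF).
  set (s := Rmin (- f x1) (f x2)).
  assert (Hs1 : s <= - f x1) by apply Rmin_l; assert (Hs2 : s <= f x2) by apply Rmin_r.
  assert (Hs : 0 < s) by (apply Rmin_glb_lt; lra).
  set (mu1 := Rmin (Rmin (mu0 / 2) 1) (s / (C + 1))).
  assert (Hmu1 : 0 < mu1).
  { repeat apply Rmin_glb_lt; try lra; apply Rdiv_lt_0_compat; lra. }
  assert (Ha : mu1 <= Rmin (mu0 / 2) 1) by apply Rmin_l.
  assert (Hb := Rmin_l (mu0 / 2) 1); assert (Hc := Rmin_r (mu0 / 2) 1).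
  assert (Hd : mu1 <= s / (C + 1)) by apply Rmin_r.
  exists mu1; split; [lra|]; intros mu Hmu.
  assert (HFl := class_R_lift _ _ _ _ _ _ _ HF mu ltac:(lra)).
  assert (E1 := Hexp x1 mu ltac:(lra) ltac:(lra)).
  assert (E2 := Hexp x2 mu ltac:(lra) ltac:(lra)).
  apply Rabs_le_between in E1; apply Rabs_le_between in E2.
  assert (Hsmall : C * mu ^ 2 <= Rabs mu * s).
  { assert (Hsq : mu ^ 2 = Rabs mu * Rabs mu)
      by (rewrite <- Rabs_mult, Rabs_pos_eq; nra).
    rewrite Hsq; assert (H := Rabs_pos mu).
    assert ((C + 1) * Rabs mu <= s).
    { apply Rle_trans with ((C + 1) * (s / (C + 1))).
      - apply Rmult_le_compat_l; lra.
      - right; field; lra. }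
    nra. }
  assert (Hmus : Rabs mu * s <= Rabs mu * INR Q * s).
  { assert (0 <= Rabs mu * s) by (apply Rmult_le_pos; [apply Rabs_pos | lra]); nra. }
  apply Rmult_eq_reg_l with (INR Q); [|lra].
  replace (INR Q * (IZR p / IZR q)) with (IZR p) by (rewrite HQ; field; lra).
  destruct (Rle_dec 0 mu) as [Hpos|Hneg].
  - rewrite Rabs_pos_eq in Hsmall, Hmus by exact Hpos.
    assert (Hm : 0 <= mu * INR Q) by nra.
    apply Rle_antisym.
    + apply (rotation_number_le_of_point _ Q p x1); auto.
      assert (mu * INR Q * s <= mu * INR Q * - f x1) by now apply Rmult_le_compat_l.
      lra.
    + apply (rotation_number_ge_of_point _ Q p x2); auto.
      assert (mu * INR Q * s <= mu * INR Q * f x2) by now apply Rmult_le_compat_l.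
      lra.
  - rewrite Rabs_left in Hsmall, Hmus by lra.
    assert (Hm : 0 <= - mu * INR Q) by nra.
    apply Rle_antisym.
    + apply (rotation_number_le_of_point _ Q p x2); auto.
      assert (- mu * INR Q * s <= - mu * INR Q * f x2) by now apply Rmult_le_compat_l.
      lra.
    + apply (rotation_number_ge_of_point _ Q p x1); auto.
      assert (- mu * INR Q * s <= - mu * INR Q * - f x1) by now apply Rmult_le_compat_l.
      lra.
Qed.

(** * The Dirichlet kernel *)

Fixpoint dirichlet_kernel (N : nat) (t : R) : R :=
  match N with
  | O => 1
  | S n => dirichlet_kernel n t + 2 * cos (2 * PI * INR (S n) * t)
  end.

(** Multiplication by [sin (PI * t)] telescopes the sum. *)
Lemma dirichlet_kernel_closed_form (N : nat) (t : R) :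
  sin (PI * t) * dirichlet_kernel N t = sin ((2 * INR N + 1) * PI * t).
Proof.
  induction N as [|N IH].
  - simpl; rewrite Rmult_1_r; f_equal; ring.
  - cbn [dirichlet_kernel]; rewrite Rmult_plus_distr_l, IH.
    set (u := 2 * PI * INR (S N) * t).
    replace ((2 * INR N + 1) * PI * t) with (u - PI * t)
      by (unfold u; rewrite S_INR; ring).
    replace ((2 * INR (S N) + 1) * PI * t) with (u + PI * t) by (unfold u; ring).
    rewrite sin_plus, sin_minus; ring.
Qed.

Lemma continuous_cos_linear (w t : R) : continuous (fun s => cos (w * s)) t.
Proof.
  apply (ex_derive_continuous (V := R_NormedModule)); auto_derive; easy.
Qed.

Lemma dirichlet_kernel_continuous (N : nat) (t : R) :
  continuous (dirichlet_kernel N) t.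
Proof.
  induction N as [|N IH].
  - apply continuous_const.
  - apply (continuous_plus (dirichlet_kernel N)); [exact IH|].
    apply (continuous_scal_r 2 (fun s => cos (2 * PI * INR (S N) * s))).
    apply continuous_cos_linear.
Qed.

Lemma dirichlet_kernel_periodic1 (N : nat) : periodic1 (dirichlet_kernel N).
Proof.
  intros t; induction N as [|N IH]; [easy|].
  cbn [dirichlet_kernel]; rewrite IH; do 2 f_equal.
  replace (2 * PI * INR (S N) * (t + 1))
    with (2 * PI * INR (S N) * t + 2 * INR (S N) * PI) by ring.
  apply cos_period.
Qed.

Lemma RInt_cos_full_period (n : nat) :
  RInt (fun t => cos (2 * PI * INR (S n) * t)) 0 1 = 0.
Proof.
  assert (HPI := PI_RGT_0); assert (Hn := lt_0_INR (S n) (Nat.lt_0_succ n)).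
  assert (Hw : 2 * PI * INR (S n) <> 0) by (apply Rgt_not_eq; nra).
  set (w := 2 * PI * INR (S n)) in *.
  apply is_RInt_unique.
  replace 0 with (minus (sin (w * 1) / w) (sin (w * 0) / w)) at 2.
  - apply (is_RInt_derive (V := R_CompleteNormedModule) (fun t => sin (w * t) / w)).
    + intros t _; auto_derive; [easy | field; exact Hw].
    + intros t _; apply continuous_cos_linear.
  - rewrite Rmult_0_r, Rmult_1_r, sin_0.
    replace (sin w) with 0; [unfold minus, plus, opp; simpl; field; exact Hw|].
    symmetry; unfold w; replace (2 * PI * INR (S n)) with (0 + 2 * INR (S n) * PI) by ring.
    now rewrite sin_period, sin_0.
Qed.

Lemma RInt_dirichlet_kernel (N : nat) : RInt (dirichlet_kernel N) 0 1 = 1.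
Proof.
  induction N as [|N IH].
  - change (RInt (fun _ : R => 1) 0 1 = 1).
    rewrite (RInt_const (V := R_CompleteNormedModule)).
    unfold scal; simpl; unfold mult; simpl; ring.
  - cbn [dirichlet_kernel].
    rewrite (RInt_plus_cont (dirichlet_kernel N)
      (fun t => 2 * cos (2 * PI * INR (S N) * t))).
    + rewrite (RInt_scal_cont (fun t => cos (2 * PI * INR (S N) * t)))
        by (intros; apply continuous_cos_linear).
      rewrite IH, RInt_cos_full_period; change (1 + 2 * 0 = 1); ring.
    + apply dirichlet_kernel_continuous.
    + intros t; apply (continuous_scal_r 2 (fun s => cos (2 * PI * INR (S N) * s))).
      apply continuous_cos_linear.
Qed.

(** * Pointwise convergence of Fourier series *)

(** The Riemann-Lebesgue lemma with a rate, by one integration by parts. *)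
Lemma oscillatory_integral_bound (h h' : R -> R) (u v : R) :
  u <= v ->
  (forall t, u <= t <= v -> is_derive h t (h' t)) ->
  (forall t, u <= t <= v -> continuous h' t) ->
  exists K, 0 <= K /\ forall w, 0 < w ->
    Rabs (RInt (fun t => h t * sin (w * t)) u v) <= K / w.
Proof.
  intros Huv Hd Hc.
  destruct (continuity_ab_maj (fun t => Rabs (h' t)) u v Huv) as [tM [HM _]].
  { intros c Hcuv; apply continuity_pt_filterlim.
    apply (continuous_comp h' Rabs); [now apply Hc | apply continuous_Rabs]. }
  set (M := Rabs (h' tM)) in *; assert (HM0 : 0 <= M) by apply Rabs_pos.
  assert (Hu := Rabs_pos (h u)); assert (Hv := Rabs_pos (h v)).
  exists (Rabs (h u) + Rabs (h v) + (v - u) * M); split; [nra|].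
  intros w Hw.
  assert (Hb : forall t, Rmin u v <= t <= Rmax u v -> u <= t <= v)
    by (rewrite Rmin_left, Rmax_right by exact Huv; auto).
  set (C := fun t => - cos (w * t) / w).
  assert (HCd : forall t, is_derive C t (sin (w * t))).
  { intros t; unfold C; auto_derive; [easy | field; lra]. }
  assert (HCb : forall t, Rabs (C t) <= / w).
  { intros t; unfold C, Rdiv; rewrite Rabs_mult, Rabs_Ropp, (Rabs_pos_eq (/ w))
      by (left; now apply Rinv_0_lt_compat).
    rewrite <- (Rmult_1_l (/ w)) at 2.
    apply Rmult_le_compat_r; [left; now apply Rinv_0_lt_compat|].
    apply Rabs_le; destruct (COS_bound (w * t)); lra. }
  assert (HCc : forall t, continuous C t).
  { intros t; apply (ex_derive_continuous (V := R_NormedModule)).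
    eexists; apply HCd. }
  assert (Hex : ex_RInt (fun t => h' t * C t) u v).
  { apply (ex_RInt_continuous (V := R_CompleteNormedModule)); intros t Ht.
    apply (continuous_mult h'); auto. }
  assert (Hparts := is_RInt_scal_derive_r (V := R_CompleteNormedModule) h C h'
    (fun t => sin (w * t)) u v (RInt (fun t => h' t * C t) u v)
    (fun t Ht => Hd t (Hb t Ht)) (fun t _ => HCd t)
    (fun t Ht => Hc t (Hb t Ht))).
  specialize (Hparts ltac:(intros t _; apply (ex_derive_continuous (V := R_NormedModule));
    auto_derive; easy) (RInt_correct (V := R_CompleteNormedModule) _ _ _ Hex)).
  apply is_RInt_unique in Hparts.
  change (RInt (fun t => h t * sin (w * t)) u v
    = h v * C v - h u * C u - RInt (fun t => h' t * C t) u v) in Hparts.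
  rewrite Hparts.
  assert (Hint : Rabs (RInt (fun t => h' t * C t) u v) <= (v - u) * (M * / w)).
  { apply abs_RInt_le_const; [exact Huv | exact Hex|].
    intros t Ht; rewrite Rabs_mult.
    apply Rmult_le_compat; try apply Rabs_pos; [now apply HM | apply HCb]. }
  assert (Hbu : Rabs (h u * C u) <= Rabs (h u) * / w)
    by (rewrite Rabs_mult; now apply Rmult_le_compat_l).
  assert (Hbv : Rabs (h v * C v) <= Rabs (h v) * / w)
    by (rewrite Rabs_mult; now apply Rmult_le_compat_l).
  unfold Rdiv; rewrite !Rmult_plus_distr_r, Rmult_assoc.
  apply Rabs_le_between in Hint; apply Rabs_le_between in Hbu;
    apply Rabs_le_between in Hbv; apply Rabs_le; lra.
Qed.

(** By the closed form, the kernel is the oscillation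
    [sin ((2 * N + 1) * PI * t)] divided by [sin (PI * t)], and the quotient
    [(phi t - c) / sin (PI * t)] is [C1] where the denominator does not vanish. *)
Lemma dirichlet_integral_away_from_zero (phi : R -> R) (c u v : R) :
  C1 phi -> u <= v -> (forall t, u <= t <= v -> sin (PI * t) <> 0) ->
  exists K, 0 <= K /\ forall N,
    Rabs (RInt (fun t => (phi t - c) * dirichlet_kernel N t) u v)
    <= K / ((2 * INR N + 1) * PI).
Proof.
  intros Hphi Huv Hsin.
  destruct (oscillatory_integral_bound (fun t => (phi t - c) / sin (PI * t))
    (fun t => (Derive phi t * sin (PI * t) - (phi t - c) * (PI * cos (PI * t)))
              / sin (PI * t) ^ 2) u v Huv) as [K [HK Hb]].
  - intros t Ht; apply (is_derive_div (fun t => phi t - c) (fun t => sin (PI * t))).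
    + replace (Derive phi t) with (minus (Derive phi t) 0)
        by apply Rminus_0_r.
      apply (is_derive_minus phi (fun _ => c));
        [now apply C1_is_derive | apply (is_derive_const (V := R_NormedModule))].
    + auto_derive; [easy | ring].
    + now apply Hsin.
  - assert (Hs : forall t, continuous (fun s => sin (PI * s)) t).
    { intros t; apply (ex_derive_continuous (V := R_NormedModule)); auto_derive; easy. }
    assert (Hp : forall t, continuous (fun s => phi s - c) t).
    { intros t; apply (continuous_minus (V := R_NormedModule) phi (fun _ => c));
        [now apply C1_continuous | apply continuous_const]. }
    intros t Ht; unfold Rdiv.
    apply (continuous_mult (K := R_AbsRing)
      (fun t => Derive phi t * sin (PI * t) - (phi t - c) * (PI * cos (PI * t)))
      (fun t => / sin (PI * t) ^ 2)).
    + apply (continuous_minus (V := R_NormedModule)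
        (fun t => Derive phi t * sin (PI * t))
        (fun t => (phi t - c) * (PI * cos (PI * t)))).
      * apply (continuous_mult (K := R_AbsRing) (Derive phi) (fun t => sin (PI * t)));
          [apply Hphi | apply Hs].
      * apply (continuous_mult (K := R_AbsRing) (fun t => phi t - c)); [apply Hp|].
        apply (continuous_scal_r PI (fun t => cos (PI * t))), continuous_cos_linear.
    + apply (ex_derive_continuous (V := R_NormedModule)); auto_derive.
      apply Rmult_integral_contrapositive; split; [|rewrite Rmult_1_r]; now apply Hsin.
  - exists K; split; [exact HK|]; intros N.
    assert (HPI := PI_RGT_0); assert (HN := pos_INR N).
    specialize (Hb ((2 * INR N + 1) * PI) ltac:(nra)).
    rewrite (RInt_ext_real _ (fun t => (phi t - c) / sin (PI * t)
      * sin ((2 * INR N + 1) * PI * t))); [exact Hb|].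
    rewrite Rmin_left, Rmax_right by exact Huv; intros t Ht.
    rewrite <- dirichlet_kernel_closed_form; field; apply Hsin; lra.
Qed.

Lemma sin_PI_lower_bound (t : R) : 0 <= t <= 1 / 4 -> t <= sin (PI * t).
Proof.
  intros Ht; destruct (Req_dec t 0) as [->|Ht0].
  { rewrite Rmult_0_r, sin_0; lra. }
  assert (HPI := PI2_3_2); assert (HPI4 := PI_4).
  destruct (MVT_cor2 sin cos 0 (PI * t)) as [c [Hc Hcb]].
  - nra.
  - intros; apply derivable_pt_lim_sin.
  - assert (Hcos : 1 / 2 <= cos c).
    { rewrite <- cos_PI3; left; apply cos_decreasing_1; nra. }
    rewrite sin_0 in Hc; nra.
Qed.

Lemma sin_PI_abs_lower_bound (t : R) :
  Rabs t <= 1 / 4 -> Rabs t <= Rabs (sin (PI * t)).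
Proof.
  intros Ht; destruct (Rle_dec 0 t) as [H|H].
  - rewrite (Rabs_pos_eq t) in * by exact H.
    eapply Rle_trans; [|apply Rle_abs]; apply sin_PI_lower_bound; lra.
  - rewrite (Rabs_left t) in * by lra.
    rewrite <- Rabs_Ropp, <- sin_neg, Ropp_mult_distr_r.
    eapply Rle_trans; [|apply Rle_abs]; apply sin_PI_lower_bound; lra.
Qed.

(** Dirichlet's theorem. Near [0] the factor [phi t - phi 0 = O(t)] compensates
    the singularity [1 / sin (PI * t)] of the kernel, so a short interval around
    [0] contributes little uniformly in [N]; away from [0] the kernel
    oscillates. *)
Lemma dirichlet_pointwise_convergence (phi : R -> R) (L : R) :
  C1 phi -> 0 <= L -> (forall x y, Rabs (phi y - phi x) <= L * Rabs (y - x)) ->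
  is_lim_seq (fun N => RInt (fun t => phi t * dirichlet_kernel N t) (- (1 / 2)) (1 / 2))
    (phi 0).
Proof.
  intros Hphi HL HLip.
  assert (HPI := PI_RGT_0).
  apply is_lim_seq_spec; intros eps; assert (Heps := cond_pos eps).
  (* The integrand is at most [L] near [0], so [2 * delta * L <= eps / 2]
     suffices there; [1 / 4] is where [|t| <= |sin (PI * t)|] is available. *)
  set (delta := Rmin (1 / 4) (eps / (4 * (L + 1)))).
  assert (Hd1 : delta <= 1 / 4) by apply Rmin_l.
  assert (Hd2 : delta <= eps / (4 * (L + 1))) by apply Rmin_r.
  assert (Hd0 : 0 < delta).
  { apply Rmin_glb_lt; [lra | apply Rdiv_lt_0_compat; lra]. }
  assert (HdL : 2 * delta * L <= eps / 2).
  { assert (delta * (L + 1) <= eps / (4 * (L + 1)) * (L + 1))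
      by (apply Rmult_le_compat_r; lra).
    replace (eps / (4 * (L + 1)) * (L + 1)) with (eps / 4) in H by (field; lra).
    nra. }
  destruct (dirichlet_integral_away_from_zero phi (phi 0) (- (1 / 2)) (- delta) Hphi)
    as [K1 [HK1 Hb1]]; [lra| |].
  { intros t Ht; apply Rlt_not_eq.
    rewrite <- (Ropp_involutive t), <- Ropp_mult_distr_r, sin_neg.
    assert (0 < sin (PI * - t)) by (apply sin_gt_0; nra); lra. }
  destruct (dirichlet_integral_away_from_zero phi (phi 0) delta (1 / 2) Hphi)
    as [K2 [HK2 Hb2]]; [lra| |].
  { intros t Ht; apply Rgt_not_eq, sin_gt_0; nra. }
  destruct (INR_unbounded (2 * (K1 + K2) / eps)) as [N0 HN0].
  exists N0; intros N HN.
  set (G := fun t => (phi t - phi 0) * dirichlet_kernel N t).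
  assert (Hc1 : forall t, continuous (fun s => phi s * dirichlet_kernel N s) t).
  { intros t; apply (continuous_mult (K := R_AbsRing) phi);
      [now apply C1_continuous | apply dirichlet_kernel_continuous]. }
  assert (Hc2 : forall t, continuous (fun s => phi 0 * dirichlet_kernel N s) t).
  { intros t; apply (continuous_scal_r (phi 0) (dirichlet_kernel N)),
      dirichlet_kernel_continuous. }
  assert (HcG : forall t, continuous G t).
  { intros t; unfold G; apply (continuous_mult (K := R_AbsRing) (fun s => phi s - phi 0));
      [|apply dirichlet_kernel_continuous].
    apply (continuous_minus (V := R_NormedModule) phi (fun _ => phi 0));
      [now apply C1_continuous | apply continuous_const]. }
  assert (Hone : RInt (dirichlet_kernel N) (- (1 / 2)) (1 / 2) = 1).
  { assert (H := RInt_periodic1_window _ (- (1 / 2)) (dirichlet_kernel_periodic1 N)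
      (dirichlet_kernel_continuous N)).
    replace (- (1 / 2) + 1) with (1 / 2) in H by field.
    now rewrite H, RInt_dirichlet_kernel. }
  assert (HG : RInt (fun t => phi t * dirichlet_kernel N t) (- (1 / 2)) (1 / 2) - phi 0
    = RInt G (- (1 / 2)) (1 / 2)).
  { rewrite (RInt_ext_real G (fun t => phi t * dirichlet_kernel N t
      - phi 0 * dirichlet_kernel N t)) by (intros t _; unfold G; ring).
    rewrite (RInt_minus_cont _ _ _ _ Hc1 Hc2).
    rewrite (RInt_scal_cont (dirichlet_kernel N)) by apply dirichlet_kernel_continuous.
    rewrite Hone, Rmult_1_r; reflexivity. }
  rewrite HG.
  rewrite <- (RInt_Chasles_cont G _ (- delta) _ HcG).
  rewrite <- (RInt_Chasles_cont G (- delta) delta _ HcG).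
  assert (Hnear : Rabs (RInt G (- delta) delta) <= (delta - - delta) * L).
  { apply abs_RInt_le_const; [lra | now apply ex_RInt_cont|].
    intros t Ht; unfold G.
    destruct (Req_dec t 0) as [->|Ht0].
    { replace (phi 0 - phi 0) with 0 by ring; rewrite Rmult_0_l, Rabs_R0; exact HL. }
    assert (Hta : Rabs t <= 1 / 4) by (apply Rabs_le; lra).
    assert (Hs := sin_PI_abs_lower_bound t Hta).
    assert (Htp := Rabs_pos_lt t Ht0).
    apply Rmult_le_reg_r with (Rabs (sin (PI * t))); [lra|].
    rewrite <- Rabs_mult, Rmult_assoc, (Rmult_comm (dirichlet_kernel N t)).
    rewrite dirichlet_kernel_closed_form, Rabs_mult.
    assert (Hl := HLip 0 t); rewrite Rminus_0_r in Hl.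
    assert (Hsb : Rabs (sin ((2 * INR N + 1) * PI * t)) <= 1).
    { apply Rabs_le; destruct (SIN_bound ((2 * INR N + 1) * PI * t)); lra. }
    assert (Hp := Rabs_pos (phi t - phi 0)).
    apply Rle_trans with (Rabs (phi t - phi 0)); nra. }
  specialize (Hb1 N); specialize (Hb2 N).
  change (Rabs (RInt G (- (1 / 2)) (- delta)) <= K1 / ((2 * INR N + 1) * PI)) in Hb1.
  change (Rabs (RInt G delta (1 / 2)) <= K2 / ((2 * INR N + 1) * PI)) in Hb2.
  assert (Hfar : K1 / ((2 * INR N + 1) * PI) + K2 / ((2 * INR N + 1) * PI) < eps / 2).
  { assert (HN' : INR N0 <= INR N) by now apply le_INR.
    assert (HNp := pos_INR N); assert (HPI3 := PI2_3_2).
    set (w := (2 * INR N + 1) * PI).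
    assert (Hw : INR N < w) by (unfold w; nra).
    replace (K1 / w + K2 / w) with ((K1 + K2) / w) by (field; lra).
    apply Rmult_lt_reg_r with w; [lra|].
    replace ((K1 + K2) / w * w) with (2 * (K1 + K2) / eps * (eps / 2)) by (field; lra).
    rewrite (Rmult_comm (eps / 2)); apply Rmult_lt_compat_r; lra. }
  apply Rabs_le_between in Hb1; apply Rabs_le_between in Hb2;
    apply Rabs_le_between in Hnear.
  apply Rabs_lt_between; lra.
Qed.

(** * Fourier coefficients at multiples of q *)

(** Each translate of [f] can be moved onto [k], which does not change. *)
Lemma RInt_birkhoff_sum_mult (f k : R -> R) (theta : R) (n : nat) :
  periodic1 f -> (forall x, continuous f x) ->
  periodic1 k -> (forall x, continuous k x) ->
  (forall x, k (x + theta) = k x) ->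
  RInt (fun y => birkhoff_sum f theta n y * k y) 0 1
  = INR n * RInt (fun y => f y * k y) 0 1.
Proof.
  intros Hfp Hf Hkp Hk Hinv.
  assert (Hinvn : forall j x, k (x + INR j * theta) = k x).
  { induction j as [|j IH]; intros x.
    - f_equal; simpl; ring.
    - rewrite S_INR; replace (x + (INR j + 1) * theta) with (x + INR j * theta + theta)
        by ring; now rewrite Hinv. }
  assert (Hfk : forall x, continuous (fun y => f y * k y) x)
    by (intros x; now apply (continuous_mult (K := R_AbsRing) f k)).
  induction n as [|n IH].
  - simpl; rewrite Rmult_0_l, (RInt_scal_cont k) by exact Hk; apply Rmult_0_l.
  - rewrite (RInt_ext_real _ (fun y => birkhoff_sum f theta n y * k y
      + f (y + INR n * theta) * k (y + INR n * theta))).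
    2: { intros y _; simpl; rewrite Hinvn; ring. }
    rewrite (RInt_plus_cont (fun y => birkhoff_sum f theta n y * k y)
      (fun y => f (y + INR n * theta) * k (y + INR n * theta))).
    + rewrite IH.
      assert (H : RInt (fun y => f (y + INR n * theta) * k (y + INR n * theta)) 0 1
        = RInt (fun y => f y * k y) 0 1).
      { apply (RInt_periodic1_translate (fun y => f y * k y)); [|exact Hfk].
        intros y; now rewrite Hfp, Hkp. }
      rewrite H, S_INR; rewrite Rmult_plus_distr_r, Rmult_1_l; reflexivity.
    + intros y; apply (continuous_mult (K := R_AbsRing) (birkhoff_sum f theta n) k);
        [|apply Hk].
      now apply birkhoff_sum_continuous.
    + intros y.
      apply (continuous_comp (fun y => y + INR n * theta) (fun y => f y * k y));
        [|apply Hfk].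
      apply (continuous_plus (V := R_NormedModule) (fun y : R => y)
        (fun _ => INR n * theta)); [apply continuous_id | apply continuous_const].
Qed.

Lemma RInt_periodic1_dilate (f : R -> R) (n : nat) :
  (0 < n)%nat -> periodic1 f -> (forall x, continuous f x) ->
  RInt (fun y => f (INR n * y)) 0 1 = RInt f 0 1.
Proof.
  intros Hn Hper Hf; assert (HnR := lt_0_INR n Hn).
  assert (H := RInt_comp_lin (V := R_CompleteNormedModule) f (INR n) 0 0 1
    (ex_RInt_cont f _ _ Hf)).
  rewrite Rmult_0_r, Rmult_1_r, !Rplus_0_r, RInt_periodic1_nat in H by assumption.
  assert (Hc : forall y, continuous (fun y => f (INR n * y)) y).
  { intros y; apply (continuous_comp (fun y => INR n * y) f); [|apply Hf].
    apply (continuous_scal_r (INR n) (fun y : R => y)), continuous_id. }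
  apply Rmult_eq_reg_l with (INR n); [|lra].
  rewrite <- (RInt_scal_cont (fun y => f (INR n * y)) _ _ _ Hc), <- H.
  apply RInt_ext_real; intros y _; now rewrite Rplus_0_r.
Qed.

Lemma continuous_mult_cos_shifted (psi : R -> R) (w x : R) :
  (forall y, continuous psi y) ->
  forall y, continuous (fun y => psi y * cos (w * (y - x))) y.
Proof.
  intros Hpsi y; apply (continuous_mult (K := R_AbsRing) psi); [apply Hpsi|].
  apply (ex_derive_continuous (V := R_NormedModule)); auto_derive; easy.
Qed.

Lemma continuous_dirichlet_kernel_dilated (q : R) (x : R) (N : nat) (y : R) :
  continuous (fun y => dirichlet_kernel N (q * (y - x))) y.
Proof.
  apply (continuous_comp (fun y => q * (y - x)) (dirichlet_kernel N));
    [|apply dirichlet_kernel_continuous].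
  apply (ex_derive_continuous (V := R_NormedModule)); auto_derive; easy.
Qed.

(** The kernel [y |-> dirichlet_kernel N (q * (y - x))] has period [1 / q], so it
    cannot distinguish [psi] from its average over the rotation by [p / q]; the
    average has period [1 / q] too, and the dilation by [q] turns the integral
    into the one of Dirichlet's theorem. *)
Lemma dirichlet_integral_at_multiples (psi : R -> R) (p q : Z) (N : nat) (x : R) :
  periodic1 psi -> C1 psi -> (1 <= q)%Z -> rel_prime p q ->
  let A := birkhoff_average psi (IZR p / IZR q) (Z.to_nat q) in
  RInt (fun y => psi y * dirichlet_kernel N (IZR q * (y - x))) 0 1
  = RInt (fun t => A (x + t / IZR q) * dirichlet_kernel N t) (- (1 / 2)) (1 / 2).
Proof.
  intros Hper HC1 Hq Hpq A.
  assert (HqR : 1 <= IZR q) by now apply IZR_le.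
  set (Q := Z.to_nat q) in *.
  assert (HQ : INR Q = IZR q) by (unfold Q; rewrite INR_IZR_INZ, Z2Nat.id; [easy | lia]).
  assert (HAc : forall y, continuous A y).
  { intros y; apply C1_continuous; now apply birkhoff_average_C1. }
  assert (HAq : forall y, A (y + / IZR q) = A y).
  { intros y; now apply birkhoff_average_period_inv_q. }
  assert (HDper := dirichlet_kernel_periodic1 N).
  assert (HDc := dirichlet_kernel_continuous N).
  set (k := fun y => dirichlet_kernel N (IZR q * (y - x))).
  assert (Hkc : forall y, continuous k y)
    by (intros y; apply continuous_dirichlet_kernel_dilated).
  assert (Hkrot : forall j y, k (y + IZR j / IZR q) = k y).
  { intros j y; unfold k.
    replace (IZR q * (y + IZR j / IZR q - x)) with (IZR q * (y - x) + IZR j)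
      by (field; lra).
    now apply periodic1_shift_Z. }
  assert (Hkper : periodic1 k).
  { intros y; rewrite <- (Hkrot q y); f_equal; field; lra. }
  assert (Havg : RInt (fun y => psi y * k y) 0 1 = RInt (fun y => A y * k y) 0 1).
  { assert (H := RInt_birkhoff_sum_mult psi k (IZR p / IZR q) Q Hper
      (fun y => C1_continuous psi y HC1) Hkper Hkc (Hkrot p)).
    rewrite (RInt_ext_real (fun y => A y * k y)
      (fun y => / INR Q * (birkhoff_sum psi (IZR p / IZR q) Q y * k y)))
      by (intros y _; unfold A, birkhoff_average, Rdiv; ring).
    rewrite (RInt_scal_cont (fun y => birkhoff_sum psi (IZR p / IZR q) Q y * k y)).
    - rewrite H, <- Rmult_assoc, Rinv_l, Rmult_1_l; [reflexivity | lra].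
    - intros y; apply (continuous_mult (K := R_AbsRing)
        (birkhoff_sum psi (IZR p / IZR q) Q) k); [|apply Hkc].
      apply birkhoff_sum_continuous; intros z; now apply C1_continuous. }
  set (Phi := fun t => A (x + t / IZR q) * dirichlet_kernel N t).
  assert (HPhic : forall t, continuous Phi t).
  { intros t; apply (continuous_mult (K := R_AbsRing) (fun t => A (x + t / IZR q)));
      [|apply HDc].
    apply (continuous_comp (fun t => x + t / IZR q) A); [|apply HAc].
    apply (ex_derive_continuous (V := R_NormedModule)); auto_derive; easy. }
  assert (HPhiper : periodic1 Phi).
  { intros t; unfold Phi.
    replace (x + (t + 1) / IZR q) with (x + t / IZR q + / IZR q) by (field; lra).
    now rewrite HDper, HAq. }
  assert (Hdil : RInt (fun y => A y * k y) 0 1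
    = RInt (fun s => Phi (s + - (IZR q * x))) 0 1).
  { rewrite <- (RInt_periodic1_dilate (fun s => Phi (s + - (IZR q * x))) Q).
    - apply RInt_ext_real; intros y _; unfold Phi, k; rewrite HQ.
      replace (IZR q * y + - (IZR q * x)) with (IZR q * (y - x)) by ring.
      replace (x + IZR q * (y - x) / IZR q) with y by (field; lra); reflexivity.
    - unfold Q; lia.
    - intros s; rewrite <- (HPhiper (s + - (IZR q * x))); f_equal; ring.
    - intros s; apply (continuous_comp (fun s => s + - (IZR q * x)) Phi); [|apply HPhic].
      apply (ex_derive_continuous (V := R_NormedModule)); auto_derive; easy. }
  assert (Hwin := RInt_periodic1_window Phi (- (1 / 2)) HPhiper HPhic).
  replace (- (1 / 2) + 1) with (1 / 2) in Hwin by field.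
  assert (Htr := RInt_periodic1_translate Phi (- (IZR q * x)) HPhiper HPhic).
  exact (eq_trans Havg (eq_trans Hdil (eq_trans Htr (eq_sym Hwin)))).
Qed.

Lemma fourier_coef_pair (psi : R -> R) (m : Z) :
  (forall y, continuous psi y) ->
  fourier_coef psi m
  = (RInt (fun y : R => psi y * cos (2 * PI * IZR m * y)) 0 1,
     - RInt (fun y : R => psi y * sin (2 * PI * IZR m * y)) 0 1).
Proof.
  intros Hpsi; unfold fourier_coef.
  assert (Hc : forall y, continuous (fun y => psi y * cos (2 * PI * IZR m * y)) y).
  { intros y; apply (continuous_mult (K := R_AbsRing) psi); [apply Hpsi|].
    apply continuous_cos_linear. }
  assert (Hs : forall y, continuous (fun y => psi y * sin (2 * PI * IZR m * y)) y).
  { intros y; apply (continuous_mult (K := R_AbsRing) psi); [apply Hpsi|].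
    apply (ex_derive_continuous (V := R_NormedModule)); auto_derive; easy. }
  apply (is_RInt_unique (V := C_R_CompleteNormedModule)).
  apply (is_RInt_fct_extend_pair (U := R_NormedModule) (V := R_NormedModule)).
  - apply (is_RInt_ext (fun y => psi y * cos (2 * PI * IZR m * y))).
    + intros y _; simpl; rewrite cos_neg, Rmult_0_l, Rminus_0_r; reflexivity.
    + apply (RInt_correct (V := R_CompleteNormedModule)), ex_RInt_cont, Hc.
  - apply (is_RInt_ext (fun y => opp (psi y * sin (2 * PI * IZR m * y)))).
    + intros y _; simpl; rewrite sin_neg, Rmult_0_l, Rplus_0_r.
      apply Ropp_mult_distr_r.
    + apply (is_RInt_opp (V := R_NormedModule)).
      apply (RInt_correct (V := R_CompleteNormedModule)), ex_RInt_cont, Hs.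
Qed.

(** Since [psi] is real, the terms of index [m] and [- m] are conjugate. *)
Lemma fourier_term_conjugate_pair (psi : R -> R) (m : Z) (x : R) :
  (forall y, continuous psi y) ->
  Cplus (fourier_term psi m x) (fourier_term psi (- m) x)
  = RtoC (2 * RInt (fun y => psi y * cos (2 * PI * IZR m * (y - x))) 0 1).
Proof.
  intros Hpsi; unfold fourier_term; rewrite !fourier_coef_pair by exact Hpsi.
  set (w := 2 * PI * IZR m).
  assert (Hw : 2 * PI * IZR (- m) = - w) by (unfold w; rewrite opp_IZR; ring).
  rewrite Hw.
  assert (Hc : forall y, continuous (fun y : R => psi y * cos (w * y)) y).
  { intros y; apply (continuous_mult (K := R_AbsRing) psi); [apply Hpsi|].
    apply continuous_cos_linear. }
  assert (Hs : forall y, continuous (fun y : R => psi y * sin (w * y)) y).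
  { intros y; apply (continuous_mult (K := R_AbsRing) psi); [apply Hpsi|].
    apply (ex_derive_continuous (V := R_NormedModule)); auto_derive; easy. }
  rewrite (RInt_ext_real (fun y => psi y * cos (- w * y)) (fun y => psi y * cos (w * y)))
    by (intros y _; rewrite <- cos_neg; do 2 f_equal; ring).
  rewrite (RInt_ext_real (fun y => psi y * sin (- w * y))
    (fun y => -1 * (psi y * sin (w * y))))
    by (intros y _; replace (- w * y) with (- (w * y)) by ring; rewrite sin_neg; ring).
  rewrite (RInt_scal_cont _ (-1) _ _ Hs).
  rewrite (RInt_ext_real (fun y => psi y * cos (w * (y - x)))
    (fun y => cos (w * x) * (psi y * cos (w * y)) + sin (w * x) * (psi y * sin (w * y))))
    by (intros y _; rewrite Rmult_minus_distr_l, cos_minus; ring).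
  rewrite (RInt_plus_cont (fun y => cos (w * x) * (psi y * cos (w * y)))
    (fun y => sin (w * x) * (psi y * sin (w * y)))).
  - rewrite (RInt_scal_cont _ _ _ _ Hc), (RInt_scal_cont _ _ _ _ Hs).
    set (u := RInt (fun y : R => psi y * cos (w * y)) 0 1).
    set (v := RInt (fun y : R => psi y * sin (w * y)) 0 1).
    clearbody u v; unfold cexpi, RtoC, Cplus, Cmult; simpl.
    replace (- w * x) with (- (w * x)) by ring; rewrite cos_neg, sin_neg.
    apply injective_projections; simpl; ring.
  - intros y; apply (continuous_scal_r (cos (w * x)) (fun y => psi y * cos (w * y))), Hc.
  - intros y; apply (continuous_scal_r (sin (w * x)) (fun y => psi y * sin (w * y))), Hs.
Qed.

Lemma sum_n_cos_integrals (psi : R -> R) (q x : R) (N : nat) :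
  (forall y, continuous psi y) -> RInt psi 0 1 = 0 ->
  sum_n (fun n => 2 * RInt (fun y => psi y
    * cos (2 * PI * (INR (S n) * q) * (y - x))) 0 1) N
  = RInt (fun y => psi y * dirichlet_kernel (S N) (q * (y - x))) 0 1.
Proof.
  intros Hpsi Hmean.
  assert (Hk : forall n y, continuous (fun y => psi y
    * dirichlet_kernel n (q * (y - x))) y).
  { intros n y; apply (continuous_mult (K := R_AbsRing) psi); [apply Hpsi|].
    apply continuous_dirichlet_kernel_dilated. }
  assert (Hstep : forall n,
    RInt (fun y => psi y * dirichlet_kernel (S n) (q * (y - x))) 0 1
    = RInt (fun y => psi y * dirichlet_kernel n (q * (y - x))) 0 1
      + 2 * RInt (fun y => psi y * cos (2 * PI * (INR (S n) * q) * (y - x))) 0 1).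
  { intros n.
    assert (Hc := continuous_mult_cos_shifted psi (2 * PI * (INR (S n) * q)) x Hpsi).
    rewrite <- (RInt_scal_cont _ 2 _ _ Hc).
    rewrite <- (RInt_plus_cont (fun y => psi y * dirichlet_kernel n (q * (y - x)))
      (fun y => 2 * (psi y * cos (2 * PI * (INR (S n) * q) * (y - x))))).
    - apply RInt_ext_real; intros y _; cbn [dirichlet_kernel].
      replace (2 * PI * INR (S n) * (q * (y - x)))
        with (2 * PI * (INR (S n) * q) * (y - x)) by ring; ring.
    - apply Hk.
    - intros y; apply (continuous_scal_r 2 (fun y => psi y
        * cos (2 * PI * (INR (S n) * q) * (y - x)))), Hc. }
  induction N as [|N IH].
  - rewrite sum_O, Hstep; cbn [dirichlet_kernel].
    rewrite (RInt_ext_real (fun y => psi y * 1) psi) by (intros; ring).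
    rewrite Hmean; symmetry; apply Rplus_0_l.
  - rewrite sum_Sn, IH, (Hstep (S N)); reflexivity.
Qed.

Lemma is_series_RtoC (u : nat -> R) (l : R) :
  is_series u l -> is_series (V := C_R_NormedModule) (fun n => RtoC (u n)) (RtoC l).
Proof.
  intros Hu; unfold is_series.
  apply (filterlim_ext (fun n => RtoC (sum_n u n))).
  { induction x as [|n IH]; [now rewrite !sum_O|].
    rewrite !sum_Sn, <- IH; apply RtoC_plus. }
  apply (filterlim_comp _ _ _ (sum_n u) RtoC _ (locally l)); [exact Hu|].
  intros P [eps HP]; exists eps; intros y Hy; apply HP; split; [exact Hy|].
  apply ball_center.
Qed.

(** Averaging over the rotation by [p / q] kills the Fourier modes that are not
    multiples of [q] and keeps the others. *)
Lemma Psi_eq_birkhoff_average (psi : R -> R) (p q : Z) (x : R) :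
  periodic1 psi -> C1 psi -> RInt psi 0 1 = 0 -> (1 <= q)%Z -> rel_prime p q ->
  Psi psi q x = birkhoff_average psi (IZR p / IZR q) (Z.to_nat q) x.
Proof.
  intros Hper HC1 Hmean Hq Hpq.
  set (A := birkhoff_average psi (IZR p / IZR q) (Z.to_nat q)).
  assert (Hpsi : forall y, continuous psi y) by (intros y; now apply C1_continuous).
  assert (HqR : 1 <= IZR q) by now apply IZR_le.
  assert (HAC1 : C1 A) by now apply birkhoff_average_C1.
  assert (HAper : periodic1 A) by now apply birkhoff_average_periodic1.
  destruct (C1_periodic_Lipschitz A HAC1 HAper) as [L [HL HLip]].
  assert (Hi : 0 < / IZR q) by (apply Rinv_0_lt_compat; lra).
  set (phi := fun t => A (x + t / IZR q)).
  assert (Hphid : forall t, is_derive phi t (/ IZR q * Derive A (x + t / IZR q))).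
  { intros t; apply (is_derive_comp A (fun t => x + t / IZR q)).
    - now apply C1_is_derive.
    - auto_derive; [easy | field; lra]. }
  assert (HphiC1 : C1 phi).
  { intros t; split; [eexists; apply Hphid|].
    apply continuous_ext with (fun t => / IZR q * Derive A (x + t / IZR q)).
    { intros s; symmetry; apply is_derive_unique, Hphid. }
    apply (continuous_scal_r (/ IZR q) (fun t => Derive A (x + t / IZR q))).
    apply (continuous_comp (fun t => x + t / IZR q) (Derive A)); [|apply HAC1].
    apply (ex_derive_continuous (V := R_NormedModule)); auto_derive; easy. }
  assert (HphiL : forall s t, Rabs (phi t - phi s) <= L * / IZR q * Rabs (t - s)).
  { intros s t; eapply Rle_trans; [apply HLip|].
    replace (x + t / IZR q - (x + s / IZR q)) with (/ IZR q * (t - s)) by (field; lra).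
    rewrite Rabs_mult, (Rabs_pos_eq (/ IZR q)) by lra; right; ring. }
  assert (Hlim := dirichlet_pointwise_convergence phi (L * / IZR q) HphiC1
    ltac:(nra) HphiL).
  assert (Hphi0 : phi 0 = A x)
    by (unfold phi; replace (x + 0 / IZR q) with x by (field; lra); reflexivity).
  rewrite Hphi0 in Hlim.
  assert (Hser : is_series (V := C_R_NormedModule) (fun n : nat =>
       Cplus (fourier_term psi (Z.of_nat (S n) * q) x)
             (fourier_term psi (- Z.of_nat (S n) * q) x)) (RtoC (A x))).
  { eapply is_series_ext; [|apply is_series_RtoC with (u := fun n =>
      2 * RInt (fun y => psi y * cos (2 * PI * (INR (S n) * IZR q) * (y - x))) 0 1)].
    - intros n; cbv beta.
      rewrite Z.mul_opp_l, fourier_term_conjugate_pair by exact Hpsi.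
      rewrite mult_IZR, <- INR_IZR_INZ; reflexivity.
    - apply (is_lim_seq_ext (fun N => RInt (fun t => phi t * dirichlet_kernel (S N) t)
        (- (1 / 2)) (1 / 2)) _ (Finite (A x))).
      + intros N; rewrite sum_n_cos_integrals by assumption.
        symmetry; now apply dirichlet_integral_at_multiples.
      + now apply (is_lim_seq_incr_1 (fun N => RInt (fun t => phi t
          * dirichlet_kernel N t) (- (1 / 2)) (1 / 2))). }
  unfold Psi, PsiC.
  rewrite (iota_unique (V := C_R_CompleteNormedModule) _ (RtoC (A x))); [easy| |exact Hser].
  intros z Hz; exact (filterlim_locally_unique (V := C_R_NormedModule) _ _ _ Hz Hser).
Qed.

(** * Derivative of the rotation number *)

Theorem theorem1p3 (p q : Z) (F : R -> R -> R) (mu0 a : R)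
    (psi : R -> R) (g : R -> R -> R)
    (hq : (1 <= q)%Z)
    (hF : class_R p q F mu0 a psi g)
    (ha : 0 < a) :
  let rho := fun mu => rotation_number (fun x => F x mu) in
  let f := fun x => a + Psi psi q x in
  ((exists m, is_min_on f 0 1 m /\ 0 < m) ->
     is_derive rho 0 (/ RInt (fun x => 1 / f x) 0 1)) /\
  ((exists m M, is_min_on f 0 1 m /\ is_max_on f 0 1 M /\ m < 0 < M) ->
     (exists mu1, 0 < mu1 < mu0 /\
        forall mu, Rabs mu < mu1 -> rho mu = IZR p / IZR q) /\
     is_derive rho 0 0).
Proof.
  intros rho f.
  assert (Hper := class_R_psi_periodic _ _ _ _ _ _ _ hF).
  set (h := fun x => a + birkhoff_average psi (IZR p / IZR q) (Z.to_nat q) x).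
  assert (Hfh : forall x, f x = h x).
  { intros x; unfold f, h; f_equal; apply Psi_eq_birkhoff_average; auto; apply hF. }
  split.
  - intros [m [[_ Hmin] Hm]].
    rewrite (RInt_ext_real (fun x => 1 / f x) (fun x => 1 / h x))
      by (intros x _; now rewrite Hfh).
    apply (rotation_number_derivative_positive_field p q F mu0 a psi g m hq hF Hm).
    intros x; destruct (exists_representative_in_unit_interval x) as [k Hk].
    rewrite <- (periodic1_shift_Z _ k x
      (birkhoff_average_periodic1 psi (IZR p / IZR q) (Z.to_nat q) Hper)).
    fold (h (x + IZR k)); rewrite <- Hfh; now apply Hmin.
  - intros [m [M [[[x1 [_ H1]] _] [[[x2 [_ H2]] _] Hs]]]].
    destruct (rotation_number_locked_of_sign_change p q F mu0 a psi g x1 x2 hq hF)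
      as [mu1 [Hmu1 Hlock]].
    { fold (h x1); rewrite <- Hfh; lra. }
    { fold (h x2); rewrite <- Hfh; lra. }
    split; [now exists mu1|].
    apply is_derive_ext_loc with (fun _ => IZR p / IZR q);
      [|apply (is_derive_const (V := R_NormedModule))].
    exists (mkposreal mu1 (proj1 Hmu1)); intros mu Hmu; symmetry; apply Hlock.
    replace mu with (mu - 0) by ring; exact Hmu.
Qed.
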